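(* For all integers $n\geq 0$ and $m\geq 0$, $$B_{5,13}\left(5^{6m}n+\frac{2\cdot 5^{6m}-2}{3}\right)\equiv 8^m B_{5,13}(n)\pmod{13},$$ and, for each $k\in\{1,5\}$, $$B_{5,13}\left(5^{6m+6}n+\frac{(3k+1)\cdot 5^{6m+5}-2}{3}\right)\equiv 0\pmod{13}.$$
   Context: For integers $l,m>1$, an $l$-regular partition is a partition none of whose parts is divisible by $l$. A $(l,m)$-regular bipartition of $n$ is a pair of partitions $(\lambda,\mu)$ such that the sum of all parts of $\lambda$ and $\mu$ is $n$, $\lambda$ is $l$-regular and $\mu$ is $m$-regular. $B_{l,m}(n)$ denotes the number of $(l,m)$-regular bipartitions of $n$; equivalently $\sum_{n\ge 0}B_{l,m}(n)q^n=\frac{f_lf_m}{f_1^2}$, where $f_k=\prod_{j\ge1}(1-q^{jk})$. *)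

(* Defs.v *)
From mathcomp Require Import all_boot.

Set Implicit Arguments.
Unset Strict Implicit.
Unset Printing Implicit Defensive.

(* A partition is the nonincreasing sequence of its (positive) parts. *)
Definition is_partition (s : seq nat) : bool :=
  sorted geq s && all (fun i => 0 < i) s.

Definition is_regular_partition (l : nat) (s : seq nat) : bool :=
  is_partition s && all (fun i => ~~ (l %| i)) s.

Definition is_regular_bipartition (l m n : nat) (p : seq nat * seq nat) : bool :=
  [&& is_regular_partition l p.1, is_regular_partition m p.2
    & sumn p.1 + sumn p.2 == n].

(* The parts of a bipartition of n are at most n, and each component has at
   most n parts, so counting inside a finite type of bounded sequences loses
   nothing: see num_regular_bipartitionsE. *)
Definition unbound n (p : {bseq n of 'I_n.+1} * {bseq n of 'I_n.+1}) :
    seq nat * seq nat :=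
  (map val p.1, map val p.2).

Definition num_regular_bipartitions (l m n : nat) : nat :=
  #|[pred p | is_regular_bipartition l m n (@unbound n p)]|.

Lemma unbound_inj n : injective (@unbound n).
Proof.
move=> [x1 x2] [y1 y2] [/(inj_map val_inj) e1 /(inj_map val_inj) e2].
by congr (_, _); apply: val_inj.
Qed.

Lemma partition_bounded n s : is_partition s -> sumn s <= n ->
  exists b : {bseq n of 'I_n.+1}, map val b = s.
Proof.
case/andP=> _ pos le_sn.
have size_le : size s <= n.
  apply: leq_trans le_sn; elim: s pos => //= i s IHs /andP[i_gt0 /IHs].
  by move=> le_s; rewrite -add1n leq_add.
have part_le : all (fun i => i <= n) s.
  elim: s {pos size_le} le_sn => //= i s IHs le_n.
  rewrite (leq_trans (leq_addr _ _) le_n) /=.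
  by apply: IHs; apply: leq_trans le_n; apply: leq_addl.
have size_b : size (map (@inord n) s) <= n by rewrite size_map.
exists (Bseq size_b); rewrite /= -map_comp -[RHS]map_id.
by apply/eq_in_map => i /(allP part_le) le_in /=; rewrite inordK.
Qed.

Lemma num_regular_bipartitionsE l m n (r : seq (seq nat * seq nat)) :
  uniq r -> (forall p, (p \in r) = is_regular_bipartition l m n p) ->
  num_regular_bipartitions l m n = size r.
Proof.
move=> uniq_r mem_r; rewrite /num_regular_bipartitions cardE.
rewrite -(size_map (@unbound n)); apply/perm_size/uniq_perm => //.
  by rewrite map_inj_uniq ?enum_uniq //; apply: unbound_inj.
move=> p; rewrite mem_r; apply/mapP/idP => [[b]|].
  by rewrite mem_enum => b_reg ->.
move=> p_reg; have /and3P[/andP[part1 _] /andP[part2 _] /eqP sum_n] := p_reg.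
have [|b1 e1] := partition_bounded (n := n) part1.
  by rewrite -sum_n leq_addr.
have [|b2 e2] := partition_bounded (n := n) part2.
  by rewrite -sum_n leq_addl.
have e : p = unbound (b1, b2).
  by case: p e1 e2 {mem_r p_reg part1 part2 sum_n} => ? ? /= <- <-.
by exists (b1, b2) => //; rewrite mem_enum inE -e.
Qed.

(* Main.v *)
(** Modulo 13, Frobenius turns the generating function [f_5 f_13 / f_1^2] into
    [A = f_1^11 f_5].  Let [U_r] extract the coefficients of the exponents
    congruent to [r] modulo 5.  Since [U_r (f(X^5) h) = f (U_r h)], applying
    [U_1] and [U_3] alternately to [A] only requires the 5-dissection
    [f_1 = a(X^5) - X f_25 + X^2 c(X^5)].  This dissection comes from the
    pentagonal number theorem; Jacobi's formula for [f_1^3] gives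
    [a c = - f_5^2], and the product of the conjugates of [f_1] under
    [X := w X], [w] a fifth root of unity, gives
    [(a^5 - 11 X f_5^5 + X^2 c^5) f_5 = f_1^6].  Hence [U_1] maps the span of
    [f_1^11 f_5], [X f_1^5 f_5^7], [X^2 f_5^13 / f_1] to that of [f_1^13 / f_5],
    [X f_1^7 f_5^5], [X^2 f_1 f_5^11], and [U_3] maps it back.  Modulo 13,
    [(U_3 U_1)^3 A = 8 A], while [U_1 (U_3 U_1)^2 A = 5 X^2 f_1 f_5^11] has no
    exponent congruent to 0 or 1 modulo 5. *)
Require Import Defs.
From HB Require Import structures.
From mathcomp Require Import all_boot all_algebra all_fingroup all_solvable.
From mathcomp Require Import all_field.
From mathcomp Require Import boolp zify ring.

Set Implicit Arguments.
Unset Strict Implicit.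
Unset Printing Implicit Defensive.

Import GRing.Theory.

(** * The ring of formal power series and congruence of series modulo a power of [X] *)

Section FormalPowerSeries.

Local Open Scope ring_scope.

Variable R : comNzRingType.

(** Series are bare coefficient functions, so functional extensionality makes coefficientwise
    equality an equality of series. *)
Definition fps : Type := nat -> R.

HB.instance Definition _ := gen_eqMixin fps.
HB.instance Definition _ := gen_choiceMixin fps.

Implicit Types (f g h : fps) (p q : {poly R}).

Lemma fpsP f g : (forall n, f n = g n) -> f = g.
Proof. exact: funext. Qed.

Definition fps_zero : fps := fun _ => 0.
Definition fps_opp f : fps := fun n => - f n.
Definition fps_add f g : fps := fun n => f n + g n.

Fact fps_addA : associative fps_add.
Proof. by move=> f g h; apply: fpsP => n; apply: addrA. Qed.
Fact fps_addC : commutative fps_add.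
Proof. by move=> f g; apply: fpsP => n; apply: addrC. Qed.
Fact fps_add0 : left_id fps_zero fps_add.
Proof. by move=> f; apply: fpsP => n; apply: add0r. Qed.
Fact fps_addN : left_inverse fps_zero fps_opp fps_add.
Proof. by move=> f; apply: fpsP => n; apply: addNr. Qed.

HB.instance Definition _ :=
  GRing.isZmodule.Build fps fps_addA fps_addC fps_add0 fps_addN.

Definition fps_of_poly p : fps := fun n => p`_n.
Definition fps_trunc n f : {poly R} := \poly_(i < n) f i.
Definition fps_mul f g : fps :=
  fun n => \sum_(i < n.+1) f i * g (n - i)%N.

Lemma coef_fps_trunc n f i : (i < n)%N -> (fps_trunc n f)`_i = f i.
Proof. by rewrite coef_poly => ->. Qed.

(** A coefficient of a product depends only on coefficients of no larger index, so the ring laws are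
    inherited from polynomial truncations. *)
Lemma fps_mulE n f g p q i : (i < n)%N ->
  (forall j, (j < n)%N -> p`_j = f j) -> (forall j, (j < n)%N -> q`_j = g j) ->
  fps_mul f g i = (p * q)`_i.
Proof.
move=> lt_in pf qg; rewrite coefM; apply: eq_bigr => j _.
by rewrite pf ?qg //; have := ltn_ord j; lia.
Qed.

Fact fps_mulC : commutative fps_mul.
Proof.
move=> f g; apply: fpsP => n.
pose F h := @coef_fps_trunc n.+1 h.
rewrite (fps_mulE (ltnSn n) (F f) (F g)) mulrC.
by rewrite -(fps_mulE (ltnSn n) (F g) (F f)).
Qed.

Fact fps_mulA : associative fps_mul.
Proof.
move=> f g h; apply: fpsP => n.
pose F h := @coef_fps_trunc n.+1 h.
have G f' g' i : (i < n.+1)%N ->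
    (fps_trunc n.+1 f' * fps_trunc n.+1 g')`_i = fps_mul f' g' i.
  by move=> lt_in; rewrite -(fps_mulE lt_in (F f') (F g')).
rewrite (fps_mulE (ltnSn n) (F f) (G g h)) mulrA.
by rewrite -(fps_mulE (ltnSn n) (G f g) (F h)).
Qed.

Fact fps_mul1 : left_id (fps_of_poly 1) fps_mul.
Proof.
move=> f; apply: fpsP => n; rewrite /fps_mul big_ord_recl /fps_of_poly.
rewrite coef1 /= mul1r subn0 big1 ?addr0 // => i _.
by rewrite coef1 /= mul0r.
Qed.

Fact fps_mulDl : left_distributive fps_mul +%R.
Proof.
move=> f g h; apply: fpsP => n.
rewrite -[RHS]/(_ + _ : R) /fps_mul -big_split /=; apply: eq_bigr => i _.
by rewrite -mulrDl.
Qed.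

Fact fps_one_neq0 : fps_of_poly 1 != 0 :> fps.
Proof.
apply/eqP => /(congr1 (fun f : fps => f 0%N)).
by rewrite /fps_of_poly coef1 => /eqP; rewrite oner_eq0.
Qed.

HB.instance Definition _ := GRing.Zmodule_isComNzRing.Build fps
  fps_mulA fps_mulC fps_mul1 fps_mulDl fps_one_neq0.

Lemma coef_fpsD f g n : (f + g) n = f n + g n. Proof. by []. Qed.
Lemma coef_fpsN f n : (- f) n = - f n. Proof. by []. Qed.
Lemma coef_fpsM f g n : (f * g) n = \sum_(i < n.+1) f i * g (n - i)%N.
Proof. by []. Qed.

Lemma coef_fps1 n : (1 : fps) n = (n == 0%N)%:R.
Proof. by rewrite -coef1. Qed.

Lemma coef_fpsMn f k n : (f *+ k) n = f n *+ k.
Proof. by elim: k => [|k IHk] //; rewrite !mulrS coef_fpsD IHk. Qed.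

Lemma coef_fps_natM k f n : (k%:R * f) n = k%:R * f n.
Proof. by rewrite !mulr_natl coef_fpsMn. Qed.

Fact fps_of_poly_zmod : zmod_morphism fps_of_poly.
Proof. by move=> p q; apply: fpsP => n; rewrite /fps_of_poly coefB. Qed.
Fact fps_of_poly_monoid : monoid_morphism fps_of_poly.
Proof.
split=> // p q; apply: fpsP => n.
by rewrite /fps_of_poly coefM.
Qed.
HB.instance Definition _ :=
  GRing.isZmodMorphism.Build {poly R} fps fps_of_poly fps_of_poly_zmod.
HB.instance Definition _ :=
  GRing.isMonoidMorphism.Build {poly R} fps fps_of_poly fps_of_poly_monoid.

Definition fpsX : fps := fps_of_poly 'X.
Definition fpsC (c : R) : fps := fps_of_poly c%:P.

Fact fpsC_zmod : zmod_morphism fpsC.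
Proof. by move=> x y; rewrite /fpsC polyCB rmorphB. Qed.
Fact fpsC_monoid : monoid_morphism fpsC.
Proof. by split=> [|x y]; rewrite /fpsC ?rmorph1 // polyCM rmorphM. Qed.
HB.instance Definition _ := GRing.isZmodMorphism.Build R fps fpsC fpsC_zmod.
HB.instance Definition _ := GRing.isMonoidMorphism.Build R fps fpsC fpsC_monoid.

Lemma coef_fpsXnM k f n :
  (fpsX ^+ k * f) n = if (n < k)%N then 0 else f (n - k)%N.
Proof.
rewrite /fpsX -rmorphXn.
rewrite -[LHS](_ : ('X^k * fps_trunc n.+1 f)`_n = _); last first.
  rewrite -(fps_mulE (ltnSn n) (f := fps_of_poly 'X^k) (g := f)) //.
  by move=> j /coef_fps_trunc.
rewrite coefXnM; case: ltnP => // le_kn.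
by rewrite coef_fps_trunc // ltnS leq_subr.
Qed.

Lemma coef_fpsXn k n : (fpsX ^+ k) n = (n == k)%:R.
Proof. by rewrite /fpsX -rmorphXn [LHS]coefXn. Qed.

(** Congruence modulo [X ^+ N.+1]. It replaces convergence: an identity between infinite sums or
    products is proved on finite ones modulo every power of [X]. *)
Definition fps_eqm N f g := forall n, (n <= N)%N -> f n = g n.

Lemma fps_eqm_sym N f g : fps_eqm N f g -> fps_eqm N g f.
Proof. by move=> e n /e. Qed.
Lemma fps_eqm_trans N f g h : fps_eqm N f g -> fps_eqm N g h -> fps_eqm N f h.
Proof. by move=> e1 e2 n le_nN; rewrite e1 ?e2. Qed.
Lemma fps_eqm_leq M N f g : (M <= N)%N -> fps_eqm N f g -> fps_eqm M f g.
Proof. by move=> le_MN e n le_n; apply/e/(leq_trans le_n). Qed.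
Lemma fps_eqmD N f f' g g' :
  fps_eqm N f f' -> fps_eqm N g g' -> fps_eqm N (f + g) (f' + g').
Proof. by move=> ef eg n le_n; rewrite !coef_fpsD ef ?eg. Qed.
Lemma fps_eqmM N f f' g g' :
  fps_eqm N f f' -> fps_eqm N g g' -> fps_eqm N (f * g) (f' * g').
Proof.
move=> ef eg n le_n; apply: eq_bigr => i _.
by have lt_in := ltn_ord i; rewrite ef ?eg //; lia.
Qed.
Lemma fps_eqmX N f g k : fps_eqm N f g -> fps_eqm N (f ^+ k) (g ^+ k).
Proof.
by move=> e; elim: k => // k IHk; rewrite !exprS; apply: fps_eqmM.
Qed.
Lemma fps_eqm_sum N (I : Type) (r : seq I) (P : pred I) (F G : I -> fps) :
  (forall i, P i -> fps_eqm N (F i) (G i)) ->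
  fps_eqm N (\sum_(i <- r | P i) F i) (\sum_(i <- r | P i) G i).
Proof. by move=> e; apply: big_ind2 => // *; apply: fps_eqmD. Qed.
Lemma fps_eqm_sum0 N (I : Type) (r : seq I) (P : pred I) (F : I -> fps) :
  (forall i, P i -> fps_eqm N (F i) 0) -> fps_eqm N (\sum_(i <- r | P i) F i) 0.
Proof.
move=> e; apply: (big_ind (fun f => fps_eqm N f 0)) => // f g ef eg.
by rewrite -[0]addr0; apply: fps_eqmD.
Qed.
Lemma fps_eqm_prod N (I : Type) (r : seq I) (P : pred I) (F G : I -> fps) :
  (forall i, P i -> fps_eqm N (F i) (G i)) ->
  fps_eqm N (\prod_(i <- r | P i) F i) (\prod_(i <- r | P i) G i).
Proof. by move=> e; apply: big_ind2 => // *; apply: fps_eqmM. Qed.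

Lemma fps_eqmXn N k f : (N < k)%N -> fps_eqm N (fpsX ^+ k * f) 0.
Proof. by move=> lt_Nk n le_n; rewrite coef_fpsXnM (leq_ltn_trans le_n). Qed.

Lemma fps_eqmXnM N k f g :
  fps_eqm N f g -> fps_eqm (N + k) (fpsX ^+ k * f) (fpsX ^+ k * g).
Proof.
move=> e n le_n; rewrite !coef_fpsXnM; case: ltnP => // _.
by apply: e; lia.
Qed.

Lemma fps_eq_of_eqm f g : (forall N, fps_eqm N f g) -> f = g.
Proof. by move=> e; apply: fpsP => n; apply: (e n). Qed.

(** The inverse is the geometric series in [1 - f], whose powers tend to 0 because its constant term
    vanishes. *)
Lemma fps_unit f : f 0%N = 1 -> exists g, f * g = 1.
Proof.
move=> f0.
pose G n := \sum_(i < n) (1 - f) ^+ i.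
have fG n : f * G n = 1 - (1 - f) ^+ n.
  have -> : f * G n = - ((1 - f - 1) * G n) by ring.
  by rewrite -subrX1 opprB.
have small n : fps_eqm n ((1 - f) ^+ n.+1) 0.
  elim: n => [|n IHn] i.
    by rewrite leqn0 => /eqP ->; rewrite expr1 coef_fpsD coef_fpsN f0 coef_fps1 subrr.
  rewrite exprS coef_fpsM => le_in; apply: big1 => j _.
  have [->|j0] := eqVneq (nat_of_ord j) 0%N.
    by rewrite coef_fpsD coef_fpsN f0 coef_fps1 subrr mul0r.
  by rewrite (IHn (i - j)%N) ?mulr0 //; lia.
(* The coefficient of index [n] no longer changes in the partial sums from [G n.+1] on, so the limit
   is read off a diagonal. *)
exists (fun n => G n.+1 n).
apply: fps_eq_of_eqm => N.
apply: (@fps_eqm_trans _ _ (f * G N.+1)).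
  apply: fps_eqmM => // i le_iN; rewrite /G.
  have -> : N.+1 = (i.+1 + (N - i))%N by lia.
  rewrite big_split_ord /=.
  rewrite coef_fpsD -[LHS]addr0; congr (_ + _).
  rewrite (@fps_eqm_sum0 i) //= => j _.
  by rewrite exprD -[0](mul0r ((1 - f) ^+ j)); apply: fps_eqmM.
by rewrite fG -[X in fps_eqm N _ X]subr0 => n /small e; rewrite !coef_fpsD !coef_fpsN e.
Qed.

End FormalPowerSeries.

(** * The substitutions [X := X ^+ k] and [X := w X], and extraction of residue classes of
    exponents *)

Section Substitutions.

Local Open Scope ring_scope.

Variable R : comNzRingType.
Implicit Types (f g h : fps R).

Definition fps_dil (k : nat) f : fps R :=
  fun n => if (k %| n)%N then f (n %/ k)%N else 0.

Fact fps_dil_zmod k : zmod_morphism (fps_dil k).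
Proof.
move=> f g; apply: fpsP => n; rewrite coef_fpsD coef_fpsN /fps_dil.
by case: ifP => _; rewrite ?subr0.
Qed.

Lemma fps_dilE k f n i : (0 < k)%N -> (i < n)%N ->
  (fps_trunc n f \Po 'X^k)`_i = fps_dil k f i.
Proof.
move=> k_gt0 lt_in; rewrite coef_comp_poly_Xn // /fps_dil coef_fps_trunc //.
by apply: leq_ltn_trans lt_in; apply: leq_div.
Qed.

Fact fps_dil_monoid k : monoid_morphism (fps_dil k.+1).
Proof.
split=> [|f g]; apply: fpsP => n.
  rewrite /fps_dil !coef_fps1; case: ifP => [/dvdnP[m ->]|]; last by case: n.
  by rewrite mulnK // muln_eq0 orbF.
have F h := fun i => @fps_dilE k.+1 h n.+1 i isT.
rewrite [RHS](fps_mulE (ltnSn n) (F f) (F g)) -rmorphM /= coef_comp_poly_Xn //.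
have lt_n : (n %/ k.+1 < n.+1)%N by rewrite ltnS leq_div.
pose T h := @coef_fps_trunc R n.+1 h.
by rewrite -(fps_mulE lt_n (T f) (T g)).
Qed.

HB.instance Definition _ k :=
  GRing.isZmodMorphism.Build (fps R) (fps R) (fps_dil k) (fps_dil_zmod k).
HB.instance Definition _ k :=
  GRing.isMonoidMorphism.Build (fps R) (fps R) (fps_dil k.+1) (fps_dil_monoid k).

Lemma fps_dilX k : fps_dil k.+1 (fpsX R) = fpsX R ^+ k.+1.
Proof.
apply: fpsP => n; rewrite coef_fpsXn /fps_dil -[fpsX R]expr1 coef_fpsXn.
case: ifP => [/dvdnP[m ->]|nd].
  by rewrite mulnK // -{2}[k.+1]mul1n eqn_pmul2r.
by case: eqP => // e; rewrite e dvdnn in nd.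
Qed.

Lemma fps_dil_dil k m f : (0 < k)%N -> (0 < m)%N ->
  fps_dil k (fps_dil m f) = fps_dil (k * m) f.
Proof.
move=> k_gt0 m_gt0; apply: fpsP => n; rewrite /fps_dil.
case: (boolP (k %| n)%N) => [/dvdnP[q ->]|nd].
  by rewrite mulnK // (mulnC q) dvdn_pmul2l // divnMl.
by rewrite ifN //; apply: contra nd; apply: dvdn_trans; apply: dvdn_mulr.
Qed.

Lemma fps_eqm_dil N k f g : (0 < k)%N -> fps_eqm N f g ->
  fps_eqm N (fps_dil k f) (fps_dil k g).
Proof.
move=> k_gt0 e n le_n; rewrite /fps_dil; case: ifP => // _.
by apply: e; apply: leq_trans le_n; apply: leq_div.
Qed.

Lemma fps_dil_inj k : (0 < k)%N -> injective (fps_dil k).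
Proof.
move=> k_gt0 f g e; apply: fpsP => n.
have := congr1 (fun h : fps R => h (k * n)%N) e.
by rewrite /fps_dil dvdn_mulr // mulKn.
Qed.

Definition fps_twist (w : R) f : fps R := fun n => w ^+ n * f n.

Fact fps_twist_zmod w : zmod_morphism (fps_twist w).
Proof.
by move=> f g; apply: fpsP => n; rewrite coef_fpsD coef_fpsN /fps_twist mulrBr.
Qed.
Fact fps_twist_monoid w : monoid_morphism (fps_twist w).
Proof.
split=> [|f g]; apply: fpsP => n; rewrite /fps_twist.
  by rewrite coef_fps1; case: n => [|n]; rewrite ?expr0 ?mulr1 ?mulr0.
rewrite !coef_fpsM mulr_sumr; apply: eq_bigr => i _.
have -> : w ^+ n = w ^+ i * w ^+ (n - i).
  by rewrite -exprD subnKC // -ltnS.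
by ring.
Qed.

HB.instance Definition _ w :=
  GRing.isZmodMorphism.Build (fps R) (fps R) (fps_twist w) (fps_twist_zmod w).
HB.instance Definition _ w :=
  GRing.isMonoidMorphism.Build (fps R) (fps R) (fps_twist w) (fps_twist_monoid w).

Lemma fps_twistX w : fps_twist w (fpsX R) = fpsC w * fpsX R.
Proof.
rewrite /fpsC /fpsX -rmorphM; apply: fpsP => n.
rewrite -[LHS]/(w ^+ n * 'X`_n) -[RHS]/((w%:P * 'X)`_n) coefCM coefX.
by case: eqP => [->|_]; rewrite ?expr1 // !mulr0.
Qed.

Lemma fps_twist_dil w k f : w ^+ k = 1 -> fps_twist w (fps_dil k f) = fps_dil k f.
Proof.
move=> wk1; apply: fpsP => n; rewrite /fps_twist /fps_dil.
case: ifP => [/dvdnP[q ->]|_]; last by rewrite mulr0.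
by rewrite mulnC exprM wk1 expr1n mul1r.
Qed.

Lemma fps_eqm_twist N w f g : fps_eqm N f g ->
  fps_eqm N (fps_twist w f) (fps_twist w g).
Proof. by move=> e n le_n; rewrite /fps_twist e. Qed.

Definition fps_section (m r : nat) f : fps R := fun n => f (m * n + r)%N.

Fact fps_section_zmod m r : zmod_morphism (fps_section m r).
Proof. by []. Qed.
HB.instance Definition _ m r := GRing.isZmodMorphism.Build (fps R) (fps R)
  (fps_section m r) (fps_section_zmod m r).

Lemma fps_sectionD m r f g :
  fps_section m r (f + g) = fps_section m r f + fps_section m r g.
Proof. by []. Qed.
Lemma fps_sectionN m r f : fps_section m r (- f) = - fps_section m r f.
Proof. by []. Qed.

Lemma coef_fpsXn_dil m s f n : (s < m)%N ->
  (fpsX R ^+ s * fps_dil m f) n = if (n %% m)%N == s then f (n %/ m)%N else 0.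
Proof.
move=> lt_sm; have m_gt0 : (0 < m)%N by apply: leq_ltn_trans lt_sm.
rewrite coef_fpsXnM /fps_dil.
have := ltn_pmod n m_gt0; have := divn_eq n m.
move: (n %/ m)%N (n %% m)%N => q t -> lt_tm.
case: ltnP => [lt_n|le_s].
  by case: eqP => // e; rewrite e in lt_n; lia.
case: eqP => [->|ne_ts].
  by rewrite addnK dvdn_mull // mulnK.
case: ifP => // /dvdnP[p ep]; case: ne_ts.
have e : (q * m + t = p * m + s)%N by lia.
by have := congr1 (modn^~ m) e; rewrite /= !modnMDl !modn_small.
Qed.

Lemma fps_section_Xn_dil m r s f : (r < m)%N -> (s < m)%N ->
  fps_section m r (fpsX R ^+ s * fps_dil m f) = if r == s then f else 0.
Proof.
move=> lt_rm lt_sm; apply: fpsP => n; rewrite /fps_section coef_fpsXn_dil //.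
rewrite mulnC modnMDl modn_small // divnMDl ?(leq_ltn_trans _ lt_rm) //.
by rewrite divn_small // addn0; case: eqP.
Qed.

Lemma fps_dissection m f : (0 < m)%N ->
  f = \sum_(s < m) fpsX R ^+ s * fps_dil m (fps_section m s f).
Proof.
move=> m_gt0; apply: fpsP => n.
have coef_sum (F : 'I_m -> fps R) : (\sum_s F s) n = \sum_s F s n.
  by elim/big_ind2: _ => // f1 x1 f2 x2 <- <-.
rewrite coef_sum (bigD1 (Ordinal (ltn_pmod n m_gt0))) //=.
rewrite coef_fpsXn_dil ?ltn_pmod // eqxx big1 ?addr0 => [|s ne_s].
  by rewrite /fps_section mulnC -divn_eq.
rewrite coef_fpsXn_dil // ifN //; apply: contra ne_s => /eqP e.
by apply/eqP/val_inj.
Qed.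

Lemma fps_section_sum m r (F : nat -> fps R) : (r < m)%N ->
  fps_section m r (\sum_(s < m) fpsX R ^+ s * fps_dil m (F s)) = F r.
Proof.
move=> lt_rm; rewrite raddf_sum (bigD1 (Ordinal lt_rm)) //=.
rewrite fps_section_Xn_dil // eqxx big1 ?addr0 // => s ne_s.
rewrite fps_section_Xn_dil // ifN //; apply: contra ne_s => /eqP e.
by apply/eqP/val_inj.
Qed.

Lemma fps_section5 r h0 h1 h2 h3 h4 : (r < 5)%N ->
  fps_section 5 r (fps_dil 5 h0 + fpsX R * fps_dil 5 h1
    + fpsX R ^+ 2 * fps_dil 5 h2 + fpsX R ^+ 3 * fps_dil 5 h3
    + fpsX R ^+ 4 * fps_dil 5 h4) = [:: h0; h1; h2; h3; h4]`_r.
Proof.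
move=> lt_r5; rewrite -(fps_section_sum (fun s => [:: h0; h1; h2; h3; h4]`_s) lt_r5).
by rewrite !big_ord_recr big_ord0 /= add0r mul1r.
Qed.

(** Multiplication by a series in [X ^+ m] preserves the residue class of each exponent, hence acts
    on each component of the dissection of [f] separately. *)
Lemma fps_section_dilM m r f g : (r < m)%N ->
  fps_section m r (fps_dil m g * f) = g * fps_section m r f.
Proof.
case: m => // m lt_rm.
rewrite {1}[f](@fps_dissection m.+1) // mulr_sumr.
under eq_bigr => s _ do rewrite mulrCA -rmorphM /=.
by rewrite (fps_section_sum (fun s => g * fps_section m.+1 s f)).
Qed.

Lemma fps_section_XM m r f : fps_section m r.+1 (fpsX R * f) = fps_section m r f.
Proof.
apply: fpsP => n; rewrite /fps_section -[fpsX R]expr1 coef_fpsXnM.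
by rewrite addnS /= subn1.
Qed.

(** Multiplication by [X] moves the last residue class to class 0 with a carry, which is the extra
    factor [X]. *)
Lemma fps_section_XM0 m f :
  fps_section m.+1 0 (fpsX R * f) = fpsX R * fps_section m.+1 m f.
Proof.
apply: fpsP => -[|n]; rewrite -[fpsX R]expr1 /fps_section !coef_fpsXnM //=.
  by rewrite muln0.
by rewrite !subn1 /= mulnS; congr (f _); lia.
Qed.

End Substitutions.

Arguments fps_dil {R} k f n : simpl never.
Arguments fps_twist {R} w f n : simpl never.
Arguments fps_section {R} m r f n : simpl never.

(** * Euler's product, the pentagonal number theorem and Jacobi's formula for its cube *)

Section EulerFunction.

Local Open Scope ring_scope.

Variable R : comNzRingType.
Implicit Types (f g h : fps R).
Notation X := (fpsX R).

Definition euler_prod n : fps R := \prod_(j < n) (1 - X ^+ j.+1).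
(** The infinite product, taken on the diagonal: factors beyond the [n]-th do not affect the
    coefficient of index [n]. *)
Definition euler : fps R := fun n => euler_prod n n.

Lemma euler_prodS n : euler_prod n.+1 = euler_prod n * (1 - X ^+ n.+1).
Proof. exact: big_ord_recr. Qed.

Lemma euler_eqm N M : (N <= M)%N -> fps_eqm N euler (euler_prod M).
Proof.
move=> le_NM n le_n; rewrite /euler.
have /subnK <- : (n <= M)%N by apply: leq_trans le_NM.
elim: (M - n)%N => // k ->; rewrite addSn euler_prodS mulrBr mulr1.
by rewrite coef_fpsD coef_fpsN mulrC coef_fpsXnM ltnS leq_addl subr0.
Qed.

Lemma euler0 : euler 0%N = 1.
Proof. by rewrite /euler /euler_prod big_ord0 coef_fps1. Qed.

Lemma fps_section_Xn m r q s : (r < m)%N -> (s < m)%N ->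
  fps_section m r (X ^+ (m * q + s)) = if r == s then X ^+ q else 0.
Proof.
case: m => // m lt_rm lt_sm; rewrite addnC exprD exprM -fps_dilX.
rewrite -(rmorphXn (fps_dil m.+1)); exact: fps_section_Xn_dil.
Qed.

(** This is n(3n+1)/2, in the shape of the exponent of the last term in Shanks' sum. Adding
    [n.*2.+1] gives (n+1)(3n+2)/2, the generalized pentagonal number of index -(n+1). *)
Definition pentagonal n := (n * n + 'C(n.+1, 2))%N.

Definition pentagonal_sum n : fps R :=
  \sum_(j < n) (-1) ^+ j * (X ^+ pentagonal j - X ^+ (pentagonal j + j.*2.+1)).

(* Shanks' finite form of the pentagonal number theorem. *)
Lemma shanks_identity n :
  \sum_(s < n) (-1) ^+ s * (\prod_(s <= j < n) (1 - X ^+ j.+1))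
                  * X ^+ (s * n + 'C(s.+1, 2)) = pentagonal_sum n.
Proof.
elim: n => [|n IHn]; first by rewrite /pentagonal_sum !big_ord0.
rewrite /pentagonal_sum [RHS]big_ord_recr -/(pentagonal_sum n) /= -IHn.
pose Q s : fps R := \prod_(s <= j < n) (1 - X ^+ j.+1).
pose t s := (-1) ^+ s * Q s * X ^+ (s * n + 'C(s.+1, 2)).
have QS s : (s < n)%N -> Q s = (1 - X ^+ s.+1) * Q s.+1.
  by move=> lt_sn; rewrite /Q big_ltn.
have Qn : Q n = 1 by rewrite /Q big_geq.
(* Passing from [n] to [n.+1] multiplies term [s] by [X ^+ s * (1 - X ^+ n.+1)]; writing this as 1
   plus a correction isolates a sum that telescopes. *)
have -> : \sum_(s < n.+1) (-1) ^+ s * (\prod_(s <= j < n.+1) (1 - X ^+ j.+1))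
             * X ^+ (s * n.+1 + 'C(s.+1, 2)) =
          \sum_(s < n.+1) t s +
          \sum_(s < n.+1) t s * (X ^+ s - 1 - X ^+ (n.+1 + s)).
  rewrite -big_split /=; apply: eq_bigr => s _.
  rewrite big_nat_recr /=; last by rewrite -ltnS.
  rewrite -/(Q s) /t.
  have -> : (s * n.+1 + 'C(s.+1, 2) = s * n + 'C(s.+1, 2) + s)%N by lia.
  by rewrite !exprD; ring.
have telescope m : (m <= n)%N ->
    \sum_(s < m.+1) t s * (X ^+ s - 1 - X ^+ (n.+1 + s)) =
    - (-1) ^+ m * Q m * X ^+ (m.+1 * n + 'C(m.+2, 2)).
  elim: m => [|m IHm] le_mn.
    rewrite big_ord_recl big_ord0 /t !mul0n !binn !bin_small //=.
    by rewrite mul1n !addn0 addn1; ring.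
  rewrite big_ord_recr IHm ?(ltnW le_mn) //= /t QS //.
  have -> : (m.+2 * n + 'C(m.+3, 2) = m.+1 * n + 'C(m.+2, 2) + (n.+1 + m.+1))%N.
    by rewrite [in LHS]binS bin1; lia.
  by rewrite !exprD ![(-1) ^+ m.+1]exprS; ring.
(* The new term [t n] and the telescoped remainder are the two halves of the new summand of
   [pentagonal_sum]. *)
rewrite telescope // big_ord_recr /= -/(t _) -addrA; congr (_ + _).
rewrite /t Qn // /pentagonal.
have -> : (n.+1 * n + 'C(n.+2, 2) = n * n + 'C(n.+1, 2) + n.*2.+1)%N.
  by rewrite [in LHS]binS bin1; lia.
by ring.
Qed.

(** In Shanks' identity the term [s = 0] is [euler_prod M], and all others are divisible by
    [X ^+ M]. *)
Lemma euler_pentagonal N M : (N < M)%N -> fps_eqm N euler (pentagonal_sum M).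
Proof.
move=> lt_NM; apply: (fps_eqm_trans (euler_eqm (ltnW lt_NM))).
rewrite -shanks_identity; case: M lt_NM => // M le_NM.
rewrite big_ord_recl /= expr0 mul0n add0n bin_small // expr0 mulr1 mul1r.
rewrite -[euler_prod _]addr0 /euler_prod big_mkord.
apply: fps_eqmD => //; apply: fps_eqm_sym.
apply: fps_eqm_sum0 => s _; rewrite mulrC; apply: fps_eqmXn.
by rewrite /bump /=; lia.
Qed.

Lemma pentagonal_double j : (2 * pentagonal j = j * (3 * j + 1))%N.
Proof.
by rewrite /pentagonal; elim: j => [|j IHj] //; rewrite binS bin1; lia.
Qed.

(** Generalized pentagonal numbers are congruent to 0, 1 or 2 modulo 5. *)
Lemma pentagonal_section0 r M : (2 < r < 5)%N ->
  fps_section 5 r (pentagonal_sum M) = 0.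
Proof.
case/andP=> lt2r lt_r5; rewrite raddf_sum big1 // => j _ /=.
have sec0 e : (e %% 5 < 3)%N -> fps_section 5 r (X ^+ e) = 0.
  move=> lt_e; rewrite (divn_eq e 5) mulnC fps_section_Xn ?ltn_pmod //.
  by case: eqP => // e_r; rewrite -e_r ltnNge lt2r in lt_e.
have res : (pentagonal j %% 5 < 3)%N /\ ((pentagonal j + j.*2.+1) %% 5 < 3)%N.
  have := pentagonal_double j; rewrite (divn_eq j 5).
  have := ltn_pmod j (isT : 0 < 5)%N.
  by case: (j %% 5)%N => [|[|[|[|[|]]]]] // _; nia.
have sec0' : fps_section 5 r (X ^+ pentagonal j - X ^+ (pentagonal j + j.*2.+1)) = 0.
  by rewrite fps_sectionD fps_sectionN !sec0 ?subrr //; case: res.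
rewrite -signr_odd; case: odd; rewrite ?expr0 ?expr1 ?mulN1r ?mul1r //.
by rewrite fps_sectionN sec0' oppr0.
Qed.

(** In each block of five indices only two of the ten exponents are 1 modulo 5. With [p] for
    [pentagonal M] they are [25 * p + 1] and [25 * (p + M.*2.+1) + 1], so together they give one
    summand of the dilated sum, with opposite sign. *)
Lemma pentagonal_section1 M :
  fps_section 5 1 (pentagonal_sum (5 * M)) = - fps_dil 5 (pentagonal_sum M).
Proof.
elim: M => [|M IHM]; first by rewrite muln0 /pentagonal_sum !big_ord0 !raddf0.
have -> : pentagonal_sum M.+1 = pentagonal_sum M
    + (-1) ^+ M * (X ^+ pentagonal M - X ^+ (pentagonal M + M.*2.+1)).
  by rewrite /pentagonal_sum big_ord_recr.
have pent s : (2 * pentagonal (5 * M + s)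
               = (5 * M + s) * (3 * (5 * M + s) + 1))%N.
  exact: pentagonal_double.
have sgn s f : fps_section 5 1 ((-1) ^+ (5 * M + s) * f)
               = (-1) ^+ M * (-1) ^+ s * fps_section 5 1 f.
  rewrite -fps_section_dilM // rmorphM !rmorphXn rmorphN1 exprD exprM.
  by rewrite -signr_odd.
have {}IHM : fps_section 5 1 (pentagonal_sum (5 * M.+1)) =
    - fps_dil 5 (pentagonal_sum M) + \sum_(s < 5) (-1) ^+ M * (-1) ^+ s *
      (fps_section 5 1 (X ^+ pentagonal (5 * M + s))
       - fps_section 5 1 (X ^+ (pentagonal (5 * M + s) + (5 * M + s).*2.+1))).
  rewrite -IHM mulnS addnC /pentagonal_sum big_split_ord /= fps_sectionD.
  congr (_ + _); rewrite (raddf_sum (fps_section 5 1)); apply: eq_bigr => s _.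
  by rewrite /= sgn fps_sectionD fps_sectionN.
rewrite IHM rmorphD opprD; congr (_ + _).
have sec e q s : (s < 5)%N -> e = (5 * q + s)%N ->
    fps_section 5 1 (X ^+ e) = if 1%N == s then X ^+ q else 0 :> fps R.
  by move=> lt_s5 ->; apply: fps_section_Xn.
have := pentagonal_double M; move: (pentagonal M) => p p2.
rewrite !big_ord_recr big_ord0 /=.
rewrite (sec (pentagonal (5 * M + 0)) (5 * p - 2 * M)%N 0%N) //;
  last by have := pent 0%N; nia.
rewrite (sec (pentagonal (5 * M + 1)) (5 * p + M)%N 2%N) //;
  last by have := pent 1%N; nia.
rewrite (sec (pentagonal (5 * M + 2)) (5 * p + 4 * M + 1)%N 2%N) //;
  last by have := pent 2%N; nia.
rewrite (sec (pentagonal (5 * M + 3)) (5 * p + 7 * M + 3)%N 0%N) //;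
  last by have := pent 3%N; nia.
rewrite (sec (pentagonal (5 * M + 4)) (5 * (p + M.*2.+1))%N 1%N) //;
  last by have := pent 4%N; nia.
rewrite (sec (pentagonal (5 * M + 0) + _)%N (5 * p)%N 1%N) //;
  last by have := pent 0%N; nia.
rewrite (sec (pentagonal (5 * M + 1) + _)%N (5 * p + 3 * M + 1)%N 0%N) //;
  last by have := pent 1%N; nia.
rewrite (sec (pentagonal (5 * M + 2) + _)%N (5 * p + 6 * M + 2)%N 2%N) //;
  last by have := pent 2%N; nia.
rewrite (sec (pentagonal (5 * M + 3) + _)%N (5 * p + 9 * M + 4)%N 2%N) //;
  last by have := pent 3%N; nia.
rewrite (sec (pentagonal (5 * M + 4) + _)%N (5 * p + 12 * M + 7)%N 0%N) //;
  last by have := pent 4%N; nia.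
rewrite rmorphM rmorphB !rmorphXn rmorphN1 /= fps_dilX -!exprM.
by ring.
Qed.

Lemma euler_section1 : fps_section 5 1 euler = - fps_dil 5 euler.
Proof.
apply: fpsP => n.
rewrite /fps_section (@euler_pentagonal (5 * n + 1) (5 * (n + 2))); [|lia..].
rewrite -[LHS]/(fps_section 5 1 _ n) pentagonal_section1 !coef_fpsN; congr (- _).
by symmetry; apply: (fps_eqm_dil (N := n)) => //; apply: euler_pentagonal; lia.
Qed.

Lemma euler_section0 r : (2 < r < 5)%N -> fps_section 5 r euler = 0.
Proof.
move=> lt_r; apply: fpsP => n.
rewrite /fps_section (euler_pentagonal (ltnSn (5 * n + r))) //.
by rewrite -[LHS]/(fps_section 5 r _ n) pentagonal_section0.
Qed.

(* The Gaussian binomial [2n+1 choose n-k], extended by symmetry to [k = -1],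
   which is why [k.-1] is harmless at [k = 0]; the recurrence is the q-Pascal
   rule applied twice. *)
Fixpoint qbinom n k : fps R :=
  match n with
  | 0 => (k == 0%N)%:R
  | n'.+1 => X ^+ (n - k) * qbinom n' k.-1
      + (1 + X ^+ (2 * n)) * qbinom n' k + X ^+ (n + k.+1) * qbinom n' k.+1
  end.

Lemma qbinomS n k : qbinom n.+1 k =
  X ^+ (n.+1 - k) * qbinom n k.-1 + (1 + X ^+ (2 * n.+1)) * qbinom n k
  + X ^+ (n.+1 + k.+1) * qbinom n k.+1.
Proof. by []. Qed.

Lemma qbinom_small n k : (n < k)%N -> qbinom n k = 0.
Proof.
elim: n k => [|n IHn] [|k] //= lt_nk.
by rewrite !IHn ?mulr0 ?addr0 //; lia.
Qed.

(** The product formula for the Gaussian binomial, free of division. It turns the recurrence into an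
    identity between products, proved by clearing denominators. *)
Lemma qbinomE n k : (k <= n)%N ->
  qbinom n k * euler_prod (n - k) * euler_prod (n + k).+1 = euler_prod (2 * n).+1.
Proof.
elim: n k => [|n IHn] k.
  by rewrite leqn0 => /eqP -> /=; rewrite /euler_prod big_ord0 !mul1r.
rewrite leq_eqVlt => /orP[/eqP ->|]; last rewrite ltnS => le_kn.
  rewrite qbinomS [qbinom n n.+1]qbinom_small // [qbinom n n.+2]qbinom_small //.
  rewrite subnn expr0 mul1r !mulr0 !addr0.
  have := IHn n (leqnn n); rewrite subnn addnn -mul2n => e.
  have -> : (n.+1 + n.+1 = (2 * n).+2)%N by lia.
  have -> : (2 * n.+1 = (2 * n).+2)%N by lia.
  by rewrite 2!euler_prodS -[X in _ = X * _ * _]e; ring.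
have e0 : qbinom n k * euler_prod (n - k) * euler_prod (n + k).+1
          = euler_prod (2 * n).+1 by apply: IHn.
have e1 : qbinom n k.-1 * euler_prod (n - k).+1 * euler_prod (n + k)
          = euler_prod (2 * n).+1.
  (* At [k = 0] the predecessor is again 0, and the formula persists because its two Euler products
     merely trade places. *)
  case: k le_kn {e0} => [|k] le_kn /=; last first.
    by rewrite -(IHn k (ltnW le_kn)) addnS subnSK.
  by rewrite -(IHn 0%N isT) subn0 addn0; ring.
have e2 : qbinom n k.+1 * euler_prod (n - k) * euler_prod (n + k).+2
          = euler_prod (2 * n).+1 * (1 - X ^+ (n - k)).
  have [lt_kn|le_nk] := ltnP k n.
    rewrite -(IHn _ lt_kn) addnS -(subnSK lt_kn) !euler_prodS.
    by ring.
  have -> : (n - k = 0)%N by lia.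
  by rewrite qbinom_small //; ring.
rewrite qbinomS.
have -> : euler_prod (2 * n.+1).+1 = euler_prod (2 * n).+3.
  by congr euler_prod; lia.
have -> : (n.+1 - k = (n - k).+1)%N by lia.
have -> : ((n.+1 + k).+1 = (n + k).+2)%N by lia.
have -> : (n.+1 + k.+1 = (n + k).+2)%N by lia.
have -> : (2 * n.+1 = (n - k).+1 + (n + k).+1)%N by lia.
rewrite [RHS](_ : _ = euler_prod (2 * n).+1 * (1 - X ^+ (n - k) * X ^+ (n + k).+2)
   * (1 - X * X ^+ (n - k) * X ^+ (n + k).+2)); last first.
  rewrite [LHS]euler_prodS [euler_prod (2 * n).+2]euler_prodS -exprS -!exprD.
  by congr (_ * (1 - X ^+ _) * (1 - X ^+ _)); lia.
transitivity (
    X ^+ (n - k).+1 * (qbinom n k.-1 * euler_prod (n - k).+1 * euler_prod (n + k))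
      * (1 - X ^+ (n + k).+1) * (1 - X ^+ (n + k).+2)
  + (1 + X ^+ (n - k).+1 * X ^+ (n + k).+1)
      * (qbinom n k * euler_prod (n - k) * euler_prod (n + k).+1)
      * (1 - X ^+ (n - k).+1) * (1 - X ^+ (n + k).+2)
  + X ^+ (n + k).+2 * (qbinom n k.+1 * euler_prod (n - k) * euler_prod (n + k).+2)
      * (1 - X ^+ (n - k).+1)).
  rewrite !euler_prodS (exprD X (n - k).+1 (n + k).+1).
  by move: (X ^+ (n - k).+1) (X ^+ (n + k).+1) (X ^+ (n + k).+2) => x y z; ring.
rewrite e0 e1 e2.
rewrite !exprS.
by move: (X ^+ (n - k)) (X ^+ (n + k)) (euler_prod _) => x y P; ring.
Qed.

(* A finite form of Jacobi's identity: the induction step reduces to the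
   vanishing of the second difference of [2k+1]. *)
Lemma jacobi_sum n M : (n <= M)%N ->
  \sum_(k < M.+1) (-1) ^+ k * (2 * k).+1%:R * X ^+ 'C(k.+1, 2) * qbinom n k
  = euler_prod n ^+ 2.
Proof.
elim: n M => [|n IHn] M le_nM.
  rewrite big_ord_recl big1 => [|i _]; last by rewrite /= mulr0.
  by rewrite /euler_prod big_ord0 /= bin_small //; ring.
pose D k := X ^+ 'C(k.+1, 2) * qbinom n k.
(* The weights [(2 * k).+1] are affine in [k], so all but the boundary terms cancel; at [k = 0],
   [D k.-1] is [D 0], as the symmetry [k -> -1 - k] requires. *)
have telescope K :
    \sum_(k < K.+1) (-1) ^+ k * (2 * k).+1%:R * (D k.-1 + D k *+ 2 + D k.+1)
    = (-1) ^+ K * ((2 * K).+1%:R * D K.+1 + (2 * K).+3%:R * D K).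
  elim: K => [|K IHK]; first by rewrite big_ord_recl big_ord0 /=; ring.
  rewrite big_ord_recr IHK /= exprS !mulnS.
  by ring.
(* The triangular exponents absorb the shifts of the recurrence, and [1 + X ^+ (2 * n.+1)] equals
   [(1 - X ^+ n.+1) ^+ 2 + 2 X ^+ n.+1], so the rest is [X ^+ n.+1] times the telescoping sum. *)
have -> : \sum_(k < M.+1)
      (-1) ^+ k * (2 * k).+1%:R * X ^+ 'C(k.+1, 2) * qbinom n.+1 k
    = (1 - X ^+ n.+1) ^+ 2 * \sum_(k < M.+1)
       (-1) ^+ k * (2 * k).+1%:R * X ^+ 'C(k.+1, 2) * qbinom n k
    + X ^+ n.+1 * \sum_(k < M.+1) (-1) ^+ k * (2 * k).+1%:R
       * (D k.-1 + D k *+ 2 + D k.+1).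
  rewrite !mulr_sumr -big_split /=; apply: eq_bigr => k _.
  have e1 : X ^+ 'C(k.+1, 2) * X ^+ (n.+1 - k) * qbinom n k.-1
            = X ^+ n.+1 * D k.-1.
    have [lt_kn|le_nk] := ltnP n.+1 k.
      by rewrite /D (@qbinom_small n) ?mulr0 //; lia.
    rewrite /D mulrA -!exprD; congr (X ^+ _ * _).
    case: (nat_of_ord k) le_nk => [|j] le_jn; first by rewrite subn0 addnC.
    by rewrite binS bin1 /=; lia.
  have e2 : X ^+ 'C(k.+1, 2) * X ^+ (n.+1 + k.+1) * qbinom n k.+1
            = X ^+ n.+1 * D k.+1.
    rewrite /D mulrA -!exprD; congr (X ^+ _ * _).
    by rewrite [in RHS]binS bin1; lia.
  have -> : X ^+ (2 * n.+1) = X ^+ n.+1 ^+ 2 by rewrite mulnC exprM.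
  rewrite [LHS](_ : _ = (-1) ^+ k * (2 * k).+1%:R *
    (X ^+ 'C(k.+1, 2) * X ^+ (n.+1 - k) * qbinom n k.-1
     + (1 + X ^+ n.+1 ^+ 2) * (X ^+ 'C(k.+1, 2) * qbinom n k)
     + X ^+ 'C(k.+1, 2) * X ^+ (n.+1 + k.+1) * qbinom n k.+1)); last by ring.
  by rewrite e1 e2 /D; ring.
rewrite telescope IHn ?(ltnW le_nM) // /D !qbinom_small ?ltnS ?(ltnW le_nM) //.
by rewrite euler_prodS; ring.
Qed.

Lemma euler_unit : exists g, euler * g = 1.
Proof. by apply: fps_unit; rewrite euler0. Qed.

(** In the product formula all three Euler products agree with [euler] to this order; one factor
    [euler] is then cancelled. *)
Lemma qbinom_eqm n k : (k <= n)%N -> fps_eqm (n - k) (qbinom n k * euler) 1.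
Proof.
move=> le_kn; have [g eg] := euler_unit.
have e : fps_eqm (n - k) (qbinom n k * euler * euler) euler.
  have E M : (n - k <= M)%N -> fps_eqm (n - k) euler (euler_prod M).
    exact: euler_eqm.
  apply: (fps_eqm_trans (g := qbinom n k * euler_prod (n - k) * euler_prod (n + k).+1)).
    by do !apply: fps_eqmM => //; apply: E => //; lia.
  by rewrite qbinomE //; apply: fps_eqm_sym; apply: E; lia.
have : fps_eqm (n - k) (qbinom n k * euler * euler * g) (euler * g).
  exact: fps_eqmM.
by rewrite -mulrA eg mulr1.
Qed.

Lemma euler_jacobi n : fps_eqm n (euler ^+ 3)
  (\sum_(k < n.+1) (-1) ^+ k * (2 * k).+1%:R * X ^+ 'C(k.+1, 2)).
Proof.
apply: fps_eqm_sym.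
apply: (fps_eqm_trans (g := (\sum_(k < n.+1)
   (-1) ^+ k * (2 * k).+1%:R * X ^+ 'C(k.+1, 2) * qbinom n k) * euler)).
  rewrite mulr_suml; apply: fps_eqm_sum => k _.
  rewrite -!mulrA; do 2!apply: fps_eqmM => //.
  have le_kn : (k <= n)%N by rewrite -ltnS.
  rewrite -[X in fps_eqm _ X]mulr1; apply: fps_eqm_sym.
  (* The approximation is only good to order [n - k], but the factor [X ^+ 'C(k.+1, 2)] restores at
     least [k] orders. *)
  apply: fps_eqm_leq (fps_eqmXnM (qbinom_eqm le_kn)).
  by rewrite -{1}(subnK le_kn) leq_add2l binS bin1 leq_addl.
rewrite jacobi_sum // [euler ^+ 3]exprSr; apply: fps_eqmM => //; apply: fps_eqmX.
exact/fps_eqm_sym/euler_eqm.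
Qed.

Lemma euler_cube_section2 : fps_section 5 2 (euler ^+ 3) = 0.
Proof.
apply: fpsP => n; rewrite /fps_section (euler_jacobi (leqnn _)).
rewrite -[LHS]/(fps_section 5 2 _ n) raddf_sum big1 // => k _ /=.
move: (nat_of_ord k) => {}k.
rewrite -signr_odd -[(2 * k).+1%:R](rmorph_nat (fps_dil 5)) -mulrA.
have -> : (-1) ^+ odd k = fps_dil 5 ((-1) ^+ odd k) :> fps R.
  by rewrite rmorphXn rmorphN1.
rewrite !fps_section_dilM // (divn_eq 'C(k.+1, 2) 5) [(_ * 5)%N]mulnC.
rewrite fps_section_Xn ?ltn_pmod //; case: eqP => [e|_]; last by rewrite !mulr0.
have : (2 * 'C(k.+1, 2) = k.+1 * k)%N by rewrite -mul_bin_diag bin1.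
rewrite (divn_eq 'C(k.+1, 2) 5) -e (divn_eq k 5).
have := ltn_pmod k (isT : 0 < 5)%N.
by case: (k %% 5)%N => [|[|[|[|[|]]]]] // _; nia.
Qed.

End EulerFunction.

(** * Products over the fifth roots of unity *)

Section FifthRootOfUnity.

Local Open Scope ring_scope.

Variables (S : comNzRingType) (w : S).
Hypothesis w_cyclotomic : 1 + w + w ^+ 2 + w ^+ 3 + w ^+ 4 = 0.

Lemma fifth_root_exp5 : w ^+ 5 = 1.
Proof.
have e : w ^+ 5 - 1 = (w - 1) * (1 + w + w ^+ 2 + w ^+ 3 + w ^+ 4) by ring.
by apply/eqP; rewrite -subr_eq0 e w_cyclotomic mulr0.
Qed.

Let w4 : w ^+ 4 = - (1 + w + w ^+ 2 + w ^+ 3).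
Proof. by apply/eqP; rewrite -addr_eq0 addrC w_cyclotomic. Qed.

(** The hypothesis on [w] is an equation valid in any commutative ring, so the identity also applies
    to the constant series [fpsC w]. *)
Lemma fifth_root_norm_form x y z :
  \prod_(i < 5) (x + w ^+ i * y + w ^+ i ^+ 2 * z)
  = x ^+ 5 + y ^+ 5 + z ^+ 5
    - 5%:R * (x * y ^+ 3 * z) + 5%:R * (x ^+ 2 * y * z ^+ 2).
Proof.
have w5 := fifth_root_exp5.
rewrite !big_ord_recr big_ord0 /= -!exprM.
have -> : w ^+ (3 * 2) = w by rewrite (exprD w 5 1) w5 mul1r.
have -> : w ^+ (4 * 2) = w ^+ 3 by rewrite (exprD w 5 3) w5 mul1r.
by ring: w4.
Qed.

(** For [s] prime to 5, raising to the power [s] permutes the fifth roots of unity. *)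
Lemma fifth_root_prod y s : (0 < s < 5)%N ->
  \prod_(i < 5) (1 - w ^+ i ^+ s * y) = 1 - y ^+ 5.
Proof.
have w5 := fifth_root_exp5.
rewrite !big_ord_recr big_ord0 /= -!exprM.
have red k t : (w ^+ (5 * k + t) = w ^+ t) by rewrite exprD exprM w5 expr1n mul1r.
case: s => [|[|[|[|[|]]]]] // _.
- by ring: w4.
- by rewrite (red 1 1)%N (red 1 3)%N; ring: w4.
- by rewrite (red 1 1)%N (red 1 4)%N (red 2 2)%N; ring: w4.
- by rewrite (red 1 3)%N (red 2 2)%N (red 3 1)%N; ring: w4.
Qed.

End FifthRootOfUnity.

(** * The 5-dissection of Euler's function and its norm *)

Section EulerDissection.

Local Open Scope ring_scope.

Variables (R : comNzRingType) (w : R).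
Hypothesis w_cyclotomic : 1 + w + w ^+ 2 + w ^+ 3 + w ^+ 4 = 0.
Hypothesis char13 : 13%:R = 0 :> R.

Notation X := (fpsX R).
Notation V := (fps_dil 5).
Notation U := (fps_section 5).
Notation phi := (euler R).
Notation g := (V phi).
Notation a := (U 0 phi).
Notation c := (U 2 phi).
Implicit Types (f h : fps R).

Lemma fps_char13 : 13%:R = 0 :> fps R.
Proof.
by apply: fpsP => n; rewrite -[13%:R]mulr1 coef_fps_natM char13 mul0r.
Qed.

Lemma euler_dissection : phi = V a - X * V g + X ^+ 2 * V c.
Proof.
rewrite {1}[phi](@fps_dissection _ 5) // !big_ord_recr big_ord0 /=.
rewrite euler_section1 (@euler_section0 _ 3) // (@euler_section0 _ 4) //.
rewrite raddfN /= raddf0.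
by ring.
Qed.

Lemma euler_section_inv : exists u, a * u = 1.
Proof. by apply: fps_unit; apply: euler0. Qed.

(** Cancellation through an explicit inverse; [phi], [a] and [g] all have constant term 1. *)
Lemma mulr_cancel (T : comNzRingType) (x u y z : T) :
  x * u = 1 -> x * y = x * z -> y = z.
Proof.
move=> xu e; rewrite -[y]mul1r -[z]mul1r -xu.
by rewrite mulrAC e mulrAC.
Qed.

(* The coefficient of [X^2] in the cube of the 5-dissection of [phi] is
   [3 a (a c + g^2)], and it vanishes because no triangular number is
   congruent to 2 modulo 5. *)
Lemma euler_section_mul : a * c = - g ^+ 2.
Proof.
have := euler_cube_section2 R.
rewrite {1}euler_dissection [_ ^+ 3](_ : _ =
    V (a ^+ 3 - 3%:R * X * g * c ^+ 2)
    + X * V (- 3%:R * a ^+ 2 * g + X * c ^+ 3)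
    + X ^+ 2 * V (3%:R * a * (a * c + g ^+ 2))
    + X ^+ 3 * V (- 6%:R * a * g * c - g ^+ 3)
    + X ^+ 4 * V (3%:R * c * (a * c + g ^+ 2))); last first.
  rewrite !(rmorphD, rmorphN, rmorphM, rmorphXn, rmorph_nat) /= !fps_dilX.
  by ring.
rewrite fps_section5 //= => e; have [u au] := euler_section_inv.
apply/eqP; rewrite -addr_eq0; apply/eqP.
(* Since 9 * 3 = 1 + 2 * 13, the factor [9%:R * u] inverts [3%:R * a]. *)
have -> : a * c + g ^+ 2 = 9%:R * u * (3%:R * a * (a * c + g ^+ 2))
    - 2%:R * 13%:R * (a * u) * (a * c + g ^+ 2)
    + (1 - a * u) * (a * c + g ^+ 2) by ring.
by rewrite e fps_char13 au; ring.
Qed.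

Definition fps_norm f : fps R := \prod_(i < 5) fps_twist (w ^+ i) f.

Lemma fps_normM : {morph fps_norm : f h / f * h}.
Proof.
by move=> f h; rewrite -big_split; apply: eq_bigr => i _; rewrite rmorphM.
Qed.

Let W := fpsC w.
Let W_cyclotomic : 1 + W + W ^+ 2 + W ^+ 3 + W ^+ 4 = 0.
Proof.
have := congr1 (@fpsC R) w_cyclotomic.
by rewrite !rmorphD !rmorphXn rmorph1 rmorph0.
Qed.
Let W5 := fifth_root_exp5 W_cyclotomic.

Lemma fps_twist_1subXn i k :
  fps_twist (w ^+ i) (1 - X ^+ k) = 1 - W ^+ i ^+ k * X ^+ k.
Proof.
rewrite rmorphB rmorph1 rmorphXn /= fps_twistX exprMn.
by rewrite /W (rmorphXn (@fpsC R)).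
Qed.

Lemma fps_norm_1subXn k s : (0 < s < 5)%N ->
  fps_norm (1 - X ^+ (5 * k + s)) = 1 - X ^+ (5 * (5 * k + s)).
Proof.
move=> s_bound; rewrite (mulnC 5 (_ + _)%N) (exprM X (5 * k + s) 5).
rewrite -(fifth_root_prod W_cyclotomic _ s_bound); apply: eq_bigr => i _.
rewrite fps_twist_1subXn [W ^+ i ^+ (_ + _)]exprD [W ^+ i ^+ (_ * _)]exprM.
by rewrite (exprAC W i 5) W5 !expr1n mul1r.
Qed.

Lemma fps_norm_1subXn5 k : fps_norm (1 - X ^+ (5 * k)) = (1 - X ^+ (5 * k)) ^+ 5.
Proof.
rewrite /fps_norm (eq_bigr (fun _ => 1 - X ^+ (5 * k))).
  by rewrite prodr_const card_ord.
move=> i _; rewrite fps_twist_1subXn [W ^+ i ^+ _]exprM (exprAC W i 5) W5.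
by rewrite !expr1n mul1r.
Qed.

(** A factor whose exponent is prime to 5 has norm [1 - X ^+ (5 * j)]; one whose exponent is
    divisible by 5 is fixed by the twists and is raised to the fifth power. The dilation by 25
    supplies the indices missing from the first kind. *)
Lemma fps_norm_euler_prod M :
  fps_norm (euler_prod R (5 * M)) * fps_dil 25 (euler_prod R M)
  = V (euler_prod R (5 * M)) * V (euler_prod R M) ^+ 5.
Proof.
elim: M => [|M IHM].
  rewrite muln0 /euler_prod !big_ord0 !rmorph1 expr1n mulr1.
  by rewrite /fps_norm big1 ?mulr1 // => i _; rewrite rmorph1.
have e5 : (5 * M.+1 = (5 * M).+4.+1)%N by lia.
have dil1 k n : fps_dil k.+1 (1 - X ^+ n) = 1 - X ^+ (k.+1 * n).
  by rewrite rmorphB rmorph1 rmorphXn /= fps_dilX exprM.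
rewrite {1 2}e5 !euler_prodS !fps_normM !rmorphM /= !dil1 -e5.
rewrite fps_norm_1subXn5 -[(5 * M).+4]addn4 -[(5 * M).+3]addn3.
rewrite -[(5 * M).+2]addn2 -[(5 * M).+1]addn1 !fps_norm_1subXn //.
rewrite -[(25 * M.+1)%N]/(5 * 5 * M.+1)%N -mulnA.
transitivity (fps_norm (euler_prod R (5 * M)) * fps_dil 25 (euler_prod R M)
  * ((1 - X ^+ (5 * (5 * M + 1))) * (1 - X ^+ (5 * (5 * M + 2)))
  * (1 - X ^+ (5 * (5 * M + 3))) * (1 - X ^+ (5 * (5 * M + 4)))
  * (1 - X ^+ (5 * M.+1)) ^+ 5 * (1 - X ^+ (5 * (5 * M.+1))))).
  by move: (fps_norm _) (fps_dil _ _) => x y; ring.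
by rewrite IHM; ring.
Qed.

Lemma fps_norm_euler : fps_norm phi * V g = g ^+ 6.
Proof.
apply: fps_eq_of_eqm => N.
have le_N : (N <= 5 * N)%N by lia.
have e1 := euler_eqm R (leqnn N); have e2 := euler_eqm R le_N.
apply: (fps_eqm_trans
  (g := fps_norm (euler_prod R (5 * N)) * fps_dil 25 (euler_prod R N))).
  apply: fps_eqmM.
    by apply: fps_eqm_prod => i _; apply: fps_eqm_twist.
  by rewrite fps_dil_dil //; apply: fps_eqm_dil.
rewrite fps_norm_euler_prod [g ^+ 6]exprS; apply: fps_eqm_sym.
by apply: fps_eqmM; [|apply: fps_eqmX]; apply: fps_eqm_dil.
Qed.

(** The norm form is applied to the three terms of the dissection. By [euler_section_mul] the mixed
    terms become multiples of [X ^+ 5 * V g ^+ 5], and 11 is 1 + 5 + 5. *)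
Lemma fps_norm_dissection :
  fps_norm phi = V (a ^+ 5 + X ^+ 2 * c ^+ 5 - 11%:R * X * g ^+ 5).
Proof.
have w5 := fifth_root_exp5 w_cyclotomic.
transitivity (\prod_(i < 5)
  (V a + W ^+ i * (- (X * V g)) + W ^+ i ^+ 2 * (X ^+ 2 * V c))).
  apply: eq_bigr => i _; rewrite {1}euler_dissection.
  rewrite !(rmorphD, rmorphN, rmorphM, rmorphXn) /= !fps_twistX.
  have wi5 : w ^+ i ^+ 5 = 1 by rewrite exprAC w5 expr1n.
  rewrite !fps_twist_dil // -/W.
  by rewrite (rmorphXn (@fpsC R)) -/W; ring.
rewrite (fifth_root_norm_form W_cyclotomic).
have := congr1 V euler_section_mul.
rewrite !(rmorphD, rmorphN, rmorphM, rmorphXn, rmorph_nat) /= !fps_dilX.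
move: (V a) (V g) (V c) => A G C AC.
by ring: AC.
Qed.

End EulerDissection.

(** * Sections of powers of Euler's function in terms of the norm *)

Section ModularEquations.

Local Open Scope ring_scope.

Variables (R : comNzRingType) (w : R).
Hypothesis w_cyclotomic : 1 + w + w ^+ 2 + w ^+ 3 + w ^+ 4 = 0.
Hypothesis char13 : 13%:R = 0 :> R.

Notation X := (fpsX R).
Notation V := (fps_dil 5).
Notation U := (fps_section 5).
Notation phi := (euler R).
Notation g := (V phi).
Notation a := (U 0 phi).
Notation c := (U 2 phi).
Notation N := (a ^+ 5 + X ^+ 2 * c ^+ 5 - 11%:R * X * g ^+ 5).

(** The norm of [phi] is computed from the product and from the dissection; the dilation [V] is
    injective. *)
Lemma euler_norm_mul : N * g = phi ^+ 6.
Proof.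
apply: (@fps_dil_inj R 5) => //.
rewrite rmorphM /= -(fps_norm_dissection w_cyclotomic char13).
by rewrite fps_norm_euler // rmorphXn.
Qed.

(** The factor [V a] eliminates [c], so powers of [phi] become polynomials in [X], [V a] and
    [V g]. *)
Lemma euler_section_scale : V a * phi = V a ^+ 2 - X * V a * V g - X ^+ 2 * V g ^+ 2.
Proof.
have := congr1 V (euler_section_mul char13).
rewrite rmorphM rmorphN rmorphXn /= => e.
transitivity (V a ^+ 2 - X * V a * V g + X ^+ 2 * (V a * V c)).
  by rewrite {2}euler_dissection; ring.
by rewrite e; ring.
Qed.

Lemma euler_norm_scale :
  a ^+ 5 * N = a ^+ 10 - 11%:R * X * a ^+ 5 * g ^+ 5 - X ^+ 2 * g ^+ 10.
Proof.
transitivity (a ^+ 10 - 11%:R * X * a ^+ 5 * g ^+ 5 + X ^+ 2 * (a * c) ^+ 5).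
  by ring.
by rewrite euler_section_mul //; ring.
Qed.

(* The monomials are kept abstract, because unification would otherwise
   unfold the unary numerals [k%:R] when ring morphisms are pushed inwards. *)
Let abstract_monomial : exists mono : nat -> nat -> nat -> nat -> fps R,
  (forall k q i j, mono k q i j = k%:R * X ^+ q * a ^+ i * g ^+ j)
  /\ (forall k q i j,
        V (mono k q i j) = k%:R * (X ^+ 5) ^+ q * V a ^+ i * V g ^+ j).
Proof.
exists (fun k q i j => k%:R * X ^+ q * a ^+ i * g ^+ j); split=> // k q i j.
by rewrite !rmorphM !rmorphXn rmorph_nat /= fps_dilX.
Qed.
Let VD (f h : fps R) : V (f + h) = V f + V h. Proof. exact: rmorphD. Qed.
Let VN (f : fps R) : V (- f) = - V f. Proof. exact: rmorphN. Qed.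

(** Pattern of the next results: scale by a power of the unit [a], expand, sort by the exponent of
    [X] modulo 5, and recognize powers of [a ^+ 5 * N] in the wanted component. *)
Lemma euler_exp5_section0 :
  U 0 (phi ^+ 5) = N.
Proof.
have [u au] := euler_section_inv R.
have auX : a ^+ 5 * u ^+ 5 = 1 by rewrite -exprMn au expr1n.
have [mono [monoE Vmono]] := abstract_monomial.
apply: (mulr_cancel auX).
rewrite -fps_section_dilM // rmorphXn /= -exprMn euler_section_scale.
rewrite [_ ^+ 5](_ : _ =
    V (mono 1 0 10 0 - mono 11 1 5 5 - mono 1 2 0 10)
    + X * V (- mono 5 0 9 1 + mono 15 1 4 6)
    + X ^+ 2 * V (mono 5 0 8 2 + mono 10 1 3 7)
    + X ^+ 3 * V (mono 10 0 7 3 - mono 5 1 2 8)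
    + X ^+ 4 * V (- mono 15 0 6 4 - mono 5 1 1 9));
  last first.
  rewrite !(VD, VN, Vmono).
  by move: (V a) (V g) => A G; ring.
rewrite fps_section5 //= !monoE.
by rewrite euler_norm_scale; ring.
Qed.

Lemma euler_exp7_section2 :
  U 2 (phi ^+ 7) = 14%:R * g ^+ 2 * N + 125%:R * X * g ^+ 7.
Proof.
have [u au] := euler_section_inv R.
have auX : a ^+ 7 * u ^+ 7 = 1 by rewrite -exprMn au expr1n.
have [mono [monoE Vmono]] := abstract_monomial.
apply: (mulr_cancel auX).
rewrite -fps_section_dilM // rmorphXn /= -exprMn euler_section_scale.
rewrite [_ ^+ 7](_ : _ =
    V (mono 1 0 14 0 + mono 14 1 9 5 + mono 49 2 4 10)
    + X * V (- mono 7 0 13 1 + mono 77 1 8 6 + mono 7 2 3 11)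
    + X ^+ 2 * V (mono 14 0 12 2 - mono 29 1 7 7 - mono 14 2 2 12)
    + X ^+ 3 * V (mono 7 0 11 3 - mono 77 1 6 8 - mono 7 2 1 13)
    + X ^+ 4 * V (- mono 49 0 10 4 + mono 14 1 5 9 - mono 1 2 0 14));
  last first.
  rewrite !(VD, VN, Vmono).
  by move: (V a) (V g) => A G; ring.
rewrite fps_section5 //= !monoE.
rewrite mulrDr [a ^+ 7 * (_ * N)](_ : _ = 14%:R * a ^+ 2 * g ^+ 2 * (a ^+ 5 * N)).
  by rewrite euler_norm_scale; ring.
by move: N => n; ring.
Qed.

Lemma euler_exp11_section1 :
  U 1 (phi ^+ 11) =
    - 11%:R * g * N ^+ 2 - 275%:R * X * g ^+ 6 * N - 3125%:R * X ^+ 2 * g ^+ 11.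
Proof.
have [u au] := euler_section_inv R.
have auX : a ^+ 11 * u ^+ 11 = 1 by rewrite -exprMn au expr1n.
have [mono [monoE Vmono]] := abstract_monomial.
apply: (mulr_cancel auX).
rewrite -fps_section_dilM // rmorphXn /= -exprMn euler_section_scale.
rewrite [_ ^+ 11](_ : _ =
    V (mono 1 0 22 0 + mono 363 1 17 5 - mono 946 2 12 10 - mono 858 3 7 15
         - mono 44 4 2 20)
    + X * V (- mono 11 0 21 1 - mono 33 1 16 6 - mono 1409 2 11 11 + mono 33 3 6 16
             - mono 11 4 1 21)
    + X ^+ 2 * V (mono 44 0 20 2 - mono 858 1 15 7 + mono 946 2 10 12
                  + mono 363 3 5 17 - mono 1 4 0 22)
    + X ^+ 3 * V (- mono 55 0 19 3 + mono 495 1 14 8 + mono 1265 2 9 13 + mono 110 3 4 18)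
    + X ^+ 4 * V (- mono 110 0 18 4 + mono 1265 1 13 9
                  - mono 495 2 8 14 - mono 55 3 3 19));
  last first.
  rewrite !(VD, VN, Vmono).
  by move: (V a) (V g) => A G; ring.
rewrite fps_section5 //= !monoE.
transitivity (- 11%:R * a * g * (a ^+ 5 * N) ^+ 2
    - 275%:R * X * a ^+ 6 * g ^+ 6 * (a ^+ 5 * N) - 3125%:R * X ^+ 2 * a ^+ 11 * g ^+ 11).
  by rewrite euler_norm_scale; ring.
by move: N => n; ring.
Qed.


(** The inverse of [phi] is the product of its other conjugates divided by the norm, so
    [V (a ^+ 5 * N) * f] is a polynomial in [X], [V a] and [V g]. *)
Lemma euler_inv_section4 f : phi * f = 1 -> N * U 4 f = 5%:R * g ^+ 4.
Proof.
move=> phi_f; have [u au] := euler_section_inv R.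
have auX : a ^+ 5 * u ^+ 5 = 1 by rewrite -exprMn au expr1n.
have [mono [monoE Vmono]] := abstract_monomial.
apply: (mulr_cancel auX); rewrite mulrA -fps_section_dilM //.
rewrite [_ * f](_ : _ =
    V (mono 1 0 9 0 - mono 3 1 4 5)
    + X * V (mono 1 0 8 1 + mono 2 1 3 6)
    + X ^+ 2 * V (mono 2 0 7 2 - mono 1 1 2 7)
    + X ^+ 3 * V (mono 3 0 6 3 + mono 1 1 1 8)
    + X ^+ 4 * V (mono 5 0 5 4)); last first.
  apply: (mulr_cancel phi_f).
  rewrite mulrCA phi_f mulr1 euler_norm_scale.
  rewrite [V (_ - _)](_ : _ = V (mono 1 0 10 0 - mono 11 1 5 5 - mono 1 2 0 10));
    last by rewrite !monoE; congr V; ring.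
  rewrite !(VD, VN, Vmono).
  (* The form of degree 8 is the product of the four nontrivial conjugates of [V a * phi]. *)
  rewrite [RHS](_ : _ = (V a * phi) * (V a ^+ 8
    + X * V a ^+ 7 * V g + 2%:R * X ^+ 2 * V a ^+ 6 * V g ^+ 2
    + 3%:R * X ^+ 3 * V a ^+ 5 * V g ^+ 3 + 5%:R * X ^+ 4 * V a ^+ 4 * V g ^+ 4
    - 3%:R * X ^+ 5 * V a ^+ 3 * V g ^+ 5 + 2%:R * X ^+ 6 * V a ^+ 2 * V g ^+ 6
    - X ^+ 7 * V a * V g ^+ 7 + X ^+ 8 * V g ^+ 8)); last first.
    by move: (V a) (V g) => A G; ring.
  by rewrite euler_section_scale; move: (V a) (V g) => A G; ring.
by rewrite fps_section5 //= !monoE; ring.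
Qed.

Lemma euler_exp13 : phi ^+ 13 = fps_dil 13 phi.
Proof.
have pchar13 : 13 \in [pchar (fps R)] by rewrite inE /= fps_char13 //.
apply: fps_eq_of_eqm => M.
apply: (fps_eqm_trans (fps_eqmX 13 (euler_eqm R (leqnn M)))).
apply: (fps_eqm_trans (g := fps_dil 13 (euler_prod R M))).
  rewrite -[X in X ^+ 13]/(\prod_(j < M) _) -prodrXl rmorph_prod /=.
  apply: fps_eqm_prod => j _.
  rewrite exprDn_pchar ?exprNn_pchar ?pnatE // expr1n.
  rewrite rmorphB rmorph1 rmorphXn /= fps_dilX.
  by rewrite -!exprM mulnC.
by apply: fps_eqm_dil => //; apply/fps_eqm_sym/euler_eqm.
Qed.

(** In the dissection of [phi] at [X ^+ 13], the leading exponents 0, 13 and 26 are 0, 3 and 1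
    modulo 5, so only the middle term counts. *)
Lemma euler_exp13_section3 : U 3 (phi ^+ 13) = - (X ^+ 2 * g ^+ 13).
Proof.
rewrite -(rmorphXn V) euler_exp13 {1}euler_dissection.
rewrite !(rmorphD, rmorphN, rmorphM, rmorphXn) /= !fps_dilX.
have comm f : fps_dil 13 (V f) = V (fps_dil 13 f) by rewrite !fps_dil_dil.
rewrite !comm.
rewrite [X in U 3 X](_ : _ = V (fps_dil 13 a)
   + X * V (X ^+ 5 * fps_dil 13 c) + X ^+ 2 * V 0
   + X ^+ 3 * V (- (X ^+ 2 * V (fps_dil 13 phi))) + X ^+ 4 * V 0).
  by rewrite fps_section5.
rewrite VN !rmorphM raddf0 /= !fps_dilX.
by ring.
Qed.

End ModularEquations.

(** * The action of [U 1] and [U 3] modulo 13 on two spans of three series *)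

Section Iteration.

Local Open Scope ring_scope.

Variables (R : comNzRingType) (w : R).
Hypothesis w_cyclotomic : 1 + w + w ^+ 2 + w ^+ 3 + w ^+ 4 = 0.
Hypothesis char13 : 13%:R = 0 :> R.

Notation X := (fpsX R).
Notation V := (fps_dil 5).
Notation U := (fps_section 5).
Notation phi := (euler R).
Notation g := (V phi).

Variables (f : fps R).
Hypothesis phi_f : phi * f = 1.

Let h := V f.
Let g_h : g * h = 1.
Proof. by rewrite /h -rmorphM phi_f rmorph1. Qed.

Let a0 : fps R := phi ^+ 11 * g.
Let b0 : fps R := X * phi ^+ 5 * g ^+ 7.
Let c0 : fps R := X ^+ 2 * f * g ^+ 13.
Let a1 : fps R := phi ^+ 13 * h.
Let b1 : fps R := X * phi ^+ 7 * g ^+ 5.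
Let c1 : fps R := X ^+ 2 * phi * g ^+ 11.

Let N : fps R := phi ^+ 6 * h.
Let normE : U 0 phi ^+ 5 + X ^+ 2 * U 2 phi ^+ 5 - 11%:R * X * g ^+ 5 = N.
Proof.
apply: (mulr_cancel g_h); rewrite mulrC (euler_norm_mul w_cyclotomic char13).
by rewrite /N mulrCA g_h mulr1.
Qed.

Let UM r (p q : fps R) : (r < 5)%N -> U r (p * V q) = q * U r p.
Proof. by move=> lt_r5; rewrite mulrC fps_section_dilM. Qed.

Lemma section1_a0 : U 1 a0 = 2%:R * a1 + 11%:R * b1 + 8%:R * c1.
Proof.
rewrite UM // (euler_exp11_section1 char13) normE.
rewrite /a1 /b1 /c1 /N.
transitivity (- 11%:R * phi ^+ 13 * h * (g * h) - 275%:R * X * phi ^+ 7 * g ^+ 5 * (g * h)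
  - 3125%:R * X ^+ 2 * phi * g ^+ 11); first by ring.
rewrite g_h.
(* The coefficients -11, -275 and -3125 are reduced modulo 13 to 2, 11 and 8. *)
transitivity (2%:R * (phi ^+ 13 * h) + 11%:R * (X * phi ^+ 7 * g ^+ 5)
  + 8%:R * (X ^+ 2 * phi * g ^+ 11) - 13%:R * (phi ^+ 13 * h
  + 22%:R * (X * phi ^+ 7 * g ^+ 5) + 241%:R * (X ^+ 2 * phi * g ^+ 11))).
  by ring.
by rewrite fps_char13 // mul0r subr0.
Qed.

Lemma section1_b0 : U 1 b0 = a1.
Proof.
rewrite /b0 -(rmorphXn V) UM // fps_section_XM (euler_exp5_section0 char13) normE.
by rewrite /a1 /N; ring.
Qed.

Lemma section1_c0 : U 1 c0 = 5%:R * b1.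
Proof.
have phi_f6 : phi ^+ 6 * f ^+ 6 = 1 by rewrite -exprMn phi_f expr1n.
rewrite /c0 -(rmorphXn V) UM // expr2 -!mulrA fps_section_XM fps_section_XM0.
have := euler_inv_section4 char13 phi_f.
rewrite normE /N => e.
transitivity (X * phi ^+ 13 * (phi ^+ 6 * f ^+ 6) * (g * h) * U 4 f).
  by rewrite phi_f6 g_h; ring.
transitivity (X * phi ^+ 13 * f ^+ 6 * g * (phi ^+ 6 * h * U 4 f)); first by ring.
rewrite e /b1.
transitivity (5%:R * X * phi ^+ 7 * (phi ^+ 6 * f ^+ 6) * g ^+ 5); first by ring.
by rewrite phi_f6; ring.
Qed.

Lemma section3_a1 : U 3 a1 = - c0.
Proof.
rewrite UM // (euler_exp13_section3 char13).
by rewrite /c0; ring.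
Qed.

Lemma section3_b1 : U 3 b1 = a0 + 8%:R * b0.
Proof.
rewrite /b1 -(rmorphXn V) UM // fps_section_XM (euler_exp7_section2 char13) normE.
rewrite /N /a0 /b0.
transitivity (14%:R * phi ^+ 11 * g * (g * h) + 125%:R * X * phi ^+ 5 * g ^+ 7);
  first by ring.
rewrite g_h.
transitivity (phi ^+ 11 * g + 8%:R * (X * phi ^+ 5 * g ^+ 7)
  + 13%:R * (phi ^+ 11 * g + 9%:R * (X * phi ^+ 5 * g ^+ 7))); first by ring.
by rewrite fps_char13 // mul0r addr0.
Qed.

Lemma section3_c1 : U 3 c1 = - a0.
Proof.
rewrite /c1 -(rmorphXn V) UM // expr2 -mulrA !fps_section_XM euler_section1.
by rewrite /a0; ring.
Qed.

Lemma fps_section_natM m r k (p : fps R) :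
  fps_section m r (k%:R * p) = k%:R * fps_section m r p.
Proof.
by apply: fpsP => n; rewrite /fps_section !coef_fps_natM.
Qed.

(** [U1] and [U3] are the two 3 by 3 matrices; the iterates below are their products, with the
    multiple of 13 given explicitly to [mod13]. *)
Let U1 x y z : U 1 (x%:R * a0 + y%:R * b0 + z%:R * c0)
  = x%:R * (2%:R * a1 + 11%:R * b1 + 8%:R * c1) + y%:R * a1 + z%:R * (5%:R * b1).
Proof.
by rewrite !fps_sectionD !fps_section_natM section1_a0 section1_b0 section1_c0.
Qed.
Let U3 x y z : U 3 (x%:R * a1 + y%:R * b1 + z%:R * c1)
  = x%:R * - c0 + y%:R * (a0 + 8%:R * b0) + z%:R * - a0.
Proof.
by rewrite !fps_sectionD !fps_section_natM section3_a1 section3_b1 section3_c1.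
Qed.

Let mod13 (p q r : fps R) : p = q + 13%:R * r -> p = q.
Proof. by rewrite fps_char13 // mul0r addr0. Qed.

Lemma alternate_sections2 : U 3 (U 1 a0) = 3%:R * a0 + 10%:R * b0 + 11%:R * c0.
Proof.
rewrite section1_a0 U3; apply: (@mod13 _ _ (6%:R * b0 - c0)).
by move: a0 b0 c0 => x y z; ring.
Qed.

Lemma alternate_sections3 : U 1 (U 3 (U 1 a0)) = 3%:R * a1 + 10%:R * b1 + 11%:R * c1.
Proof.
rewrite alternate_sections2 U1; apply: (@mod13 _ _ (a1 + 6%:R * b1 + c1)).
by move: a1 b1 c1 => x y z; ring.
Qed.

Lemma alternate_sections4 : U 3 (U 1 (U 3 (U 1 a0))) = 12%:R * a0 + 2%:R * b0 + 10%:R * c0.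
Proof.
rewrite alternate_sections3 U3; apply: (@mod13 _ _ (6%:R * b0 - c0 - a0)).
by move: a0 b0 c0 => x y z; ring.
Qed.

Lemma alternate_sections5 : U 1 (U 3 (U 1 (U 3 (U 1 a0)))) = 0%:R * a1 + 0%:R * b1 + 5%:R * c1.
Proof.
rewrite alternate_sections4 U1; apply: (@mod13 _ _ (2%:R * a1 + 14%:R * b1 + 7%:R * c1)).
by move: a1 b1 c1 => x y z; ring.
Qed.

Lemma alternate_sections6 : U 3 (U 1 (U 3 (U 1 (U 3 (U 1 a0))))) = 8%:R * a0.
Proof.
rewrite alternate_sections5 U3; apply: (@mod13 _ _ (- a0)).
by move: a0 b0 c0 => x y z; ring.
Qed.

(** Only a multiple of [c1] remains. Up to a series in [X ^+ 5] it is [X ^+ 2 * phi], whose classes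
    0 and 1 are classes 3 and 4 of [phi], both empty. *)
Lemma alternate_sections5_vanish r : (r < 2)%N -> U r (U 1 (U 3 (U 1 (U 3 (U 1 a0))))) = 0.
Proof.
move=> lt_r2; rewrite alternate_sections5 !mul0r !add0r fps_section_natM.
rewrite /c1 -(rmorphXn V) UM ?(leq_trans lt_r2) // expr2 -mulrA.
case: r lt_r2 => [|[|]] // _.
  by rewrite fps_section_XM0 fps_section_XM euler_section0 // !mulr0.
by rewrite fps_section_XM fps_section_XM0 euler_section0 // !mulr0.
Qed.

End Iteration.

(** * Enumeration of regular partitions and their generating function *)

Section RegularPartitions.

Variable l : nat.

(** Here [k] bounds the parts and [d] is fuel: each call lowers [k + n], either by excluding [k] as
    a part or by removing one part equal to [k]. *)
Fixpoint regular_partitions_rec d k n : seq (seq nat) :=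
  if d is d'.+1 then
    if k is k'.+1 then
      regular_partitions_rec d' k' n ++
      (if ~~ (l %| k) && (k <= n)
       then map (cons k) (regular_partitions_rec d' k (n - k)) else [::])
    else if n == 0 then [:: [::]] else [::]
  else if n == 0 then [:: [::]] else [::].

Definition regular_partitions k n := regular_partitions_rec (k + n) k n.

Lemma mem_regular_partitions_rec d k n s : k + n <= d ->
  (s \in regular_partitions_rec d k n) =
  [&& is_regular_partition l s, path geq k s & sumn s == n].
Proof.
have base m t : (t \in (if m == 0 then [:: [::]] else [::] : seq (seq nat)))
    = [&& is_regular_partition l t, path geq 0 t & sumn t == m].
  case: t => [|x t] /=; first by rewrite eq_sym; case: eqP.
  rewrite [LHS](_ : _ = false); last by case: (m == 0).
  rewrite /is_regular_partition /is_partition /=.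
  by case: x => [|x]; rewrite /= ?andbF.
elim: d k n s => [|d IHd] [|k] n s le_d //; rewrite ?base //.
rewrite [regular_partitions_rec _ _ _]/= mem_cat IHd; last by lia.
case: s => [|x s].
  rewrite /= orbC; case: ifP => //= _; case: mapP => // -[s _ //].
rewrite /is_regular_partition /is_partition /=.
have in_map y (L : seq (seq nat)) :
    (y :: s \in map (cons k.+1) L) = (y == k.+1) && (s \in L).
  apply/mapP/andP => [[t tL [-> ->]] //|[/eqP -> sL]]; by exists s.
have [->|ne_xk] := eqVneq x k.+1.
  rewrite {1}/geq ltnn andbF /=.
  case: ifP => [/andP[nd le_kn]|].
    rewrite in_map eqxx IHd; last by lia.
    rewrite /is_regular_partition /is_partition nd /= -[in RHS](subnKC le_kn).
    rewrite eqn_add2l /geq leqnn.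
    case p_s: (path _ k.+1 s); last by rewrite /= !andbF.
    by rewrite (path_sorted p_s).
  move=> /negbT; rewrite negb_and negbK -ltnNge => /orP[->|lt_nk].
    by rewrite /= !andbF.
  by rewrite (gtn_eqF (leq_trans lt_nk (leq_addr _ _))) !andbF.
have -> : (x <= k.+1) = (x <= k) by rewrite leq_eqVlt (negbTE ne_xk).
have -> L : x :: s \in (if ~~ (l %| k.+1) && (k < n)
    then map (cons k.+1) L else [::]) = false.
  by case: ifP => // _; rewrite in_map (negbTE ne_xk).
by rewrite orbF.
Qed.

Lemma uniq_regular_partitions_rec d k n : k + n <= d ->
  uniq (regular_partitions_rec d k n).
Proof.
elim: d k n => [|d IHd] [|k] n le_d //=; try by case: (n == 0).
rewrite cat_uniq IHd; last by lia.
case: ifP => //= /andP[_ le_kn].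
rewrite map_inj_uniq ?IHd ?andbT; [|lia|by move=> x y []].
apply/hasPn => _ /mapP[s _ ->]; rewrite mem_regular_partitions_rec; last by lia.
by rewrite /= ltnn andbF.
Qed.

Lemma mem_regular_partitions k n s : (s \in regular_partitions k n) =
  [&& is_regular_partition l s, path geq k s & sumn s == n].
Proof. exact: mem_regular_partitions_rec. Qed.

Lemma uniq_regular_partitions k n : uniq (regular_partitions k n).
Proof. exact: uniq_regular_partitions_rec. Qed.

Lemma size_regular_partitions_rec d k n : k + n <= d ->
  size (regular_partitions_rec d k n) = size (regular_partitions k n).
Proof.
move=> le_d; apply/perm_size/uniq_perm.
- exact: uniq_regular_partitions_rec.
- exact: uniq_regular_partitions.
by move=> s; rewrite mem_regular_partitions mem_regular_partitions_rec.
Qed.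

Lemma size_regular_partitions0 n : size (regular_partitions 0 n) = (n == 0).
Proof. by case: n. Qed.

Lemma size_regular_partitionsS k n : size (regular_partitions k.+1 n) =
  size (regular_partitions k n) +
  (if ~~ (l %| k.+1) && (k < n)
   then size (regular_partitions k.+1 (n - k.+1)) else 0).
Proof.
rewrite {1}/regular_partitions /= size_cat size_regular_partitions_rec //.
congr (_ + _); case: ifP => // /andP[_ lt_kn].
by rewrite size_map size_regular_partitions_rec //; lia.
Qed.

Lemma size_regular_partitions_stable k n : n <= k ->
  size (regular_partitions k n) = size (regular_partitions n n).
Proof.
move=> /subnK <-; elim: (k - n) => // j IHj.
by rewrite addSn size_regular_partitionsS ltnNge leq_addl andbF addn0.
Qed.

Lemma mem_regular_partitions_all n s : (s \in regular_partitions n n) =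
  is_regular_partition l s && (sumn s == n).
Proof.
rewrite mem_regular_partitions.
case: (eqVneq (sumn s) n) => [<-|]; last by rewrite !andbF.
rewrite !andbT; case: (boolP (is_regular_partition l s)) => //=.
case: s => //= x s; rewrite /is_regular_partition /is_partition /=.
by case/andP=> /andP[-> _] _; rewrite /geq /= leq_addr.
Qed.

Local Open Scope ring_scope.
Variable R : comNzRingType.
Notation X := (fpsX R).

Let P k : fps R := fun n => (size (regular_partitions k n))%:R.

Let PS k : P k.+1 = P k + (if (l %| k.+1)%N then 0 else X ^+ k.+1 * P k.+1).
Proof.
apply: fpsP => n; rewrite coef_fpsD {1}/P size_regular_partitionsS natrD.
congr (_ + _); case: (boolP (l %| k.+1)%N) => //= _.
by rewrite coef_fpsXnM ltnS; case: ltnP.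
Qed.

(** By [PS], the factor [1 - X ^+ k.+1] turns [P k.+1] into [P k] when [k.+1] is an allowed part,
    and otherwise the two series coincide. *)
Lemma fps_bounded_regular_partitions k :
  P k * \prod_(j < k | ~~ (l %| j.+1)%N) (1 - X ^+ j.+1) = 1.
Proof.
elim: k => [|k IHk].
  rewrite big_ord0 mulr1; apply: fpsP => n.
  by rewrite /P size_regular_partitions0 coef_fps1.
rewrite big_mkcond big_ord_recr -big_mkcond /= -[RHS]IHk.
have := PS k; case: (boolP (l %| k.+1)%N) => /= _ e; first by rewrite e addr0 mulr1.
rewrite mulrCA [RHS]mulrC; congr (_ * _).
by rewrite mulrBr mulr1 {1}e [_ * X ^+ _]mulrC addrK.
Qed.

Definition regular_partition_series : fps R :=
  fun n => (size (regular_partitions n n))%:R.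

(** In each block of [l] consecutive exponents only the last is a multiple of [l]. *)
Lemma fps_dil_euler_prod N : (0 < l)%N ->
  \prod_(j < l * N | (l %| j.+1)%N) (1 - X ^+ j.+1) = fps_dil l (euler_prod R N).
Proof.
case: l => // l' _; elim: N => [|N IHN].
  by rewrite muln0 /euler_prod !big_ord0 rmorph1.
rewrite mulnS addnC big_mkcond big_split_ord -big_mkcond /= IHN.
rewrite euler_prodS rmorphM; congr (_ * _).
rewrite big_ord_recr big1 /= => [|i _].
  have -> : ((l'.+1 * N + l').+1 = l'.+1 * N.+1)%N by lia.
  rewrite mul1r dvdn_mulr //.
  by rewrite rmorphB rmorph1 rmorphXn /= fps_dilX -exprM.
rewrite ifN // -addnS dvdn_addr ?dvdn_mulr //.
by apply/negP => /dvdn_leq => /(_ isT); rewrite ltnNge; have := ltn_ord i; lia.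
Qed.

(** Splitting Euler's product by divisibility by [l], the nonmultiples cancel the series and the
    multiples form the dilated product. *)
Lemma regular_partition_series_euler : (0 < l)%N ->
  regular_partition_series * euler R = fps_dil l (euler R).
Proof.
move=> l_gt0; apply: fps_eq_of_eqm => N.
have le_N : (N <= l * N)%N by rewrite leq_pmull.
apply: (fps_eqm_trans (g := P (l * N) * euler_prod R (l * N))).
  apply: fps_eqmM; last exact: euler_eqm.
  move=> n le_n; rewrite /P size_regular_partitions_stable //.
  exact: leq_trans le_N.
apply: (fps_eqm_trans (g := fps_dil l (euler_prod R N))).
  rewrite -fps_dil_euler_prod // /euler_prod.
  rewrite (bigID (fun j : 'I__ => ~~ (l %| j.+1)%N)) /=.
  rewrite mulrA fps_bounded_regular_partitions mul1r.
  by under [in X in fps_eqm _ X _]eq_bigl => j do rewrite negbK.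
by apply: fps_eqm_dil => //; apply/fps_eqm_sym/euler_eqm.
Qed.

End RegularPartitions.

Lemma num_regular_bipartitions_conv l m n : num_regular_bipartitions l m n =
  \sum_(i < n.+1) size (regular_partitions l i i)
                  * size (regular_partitions m (n - i) (n - i)).
Proof.
pose bip i := [seq (s, t) | s <- regular_partitions l i i,
                            t <- regular_partitions m (n - i) (n - i)].
rewrite (@num_regular_bipartitionsE _ _ _ [seq p | i <- iota 0 n.+1, p <- bip i]).
- rewrite size_allpairs_dep sumnE big_map -[iota _ _]/(index_iota 0 n.+1).
  by rewrite big_mkord; apply: eq_bigr => i _; rewrite size_allpairs.
- apply: allpairs_uniq_dep; first exact: iota_uniq.
    move=> i _; apply: allpairs_uniq; try exact: uniq_regular_partitions.
    by move=> [s t] [s' t'].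
  move=> _ _ /allpairsPdep[i [p [_ pi ->]]] /allpairsPdep[j [q [_ qj ->]]] /= e.
  case/allpairsP: pi => -[s t] /= [s_i _ e1].
  case/allpairsP: qj => -[s' t'] /= [s_j _ e2].
  move: e; rewrite e1 e2 => -[es et]; rewrite -{}es -{}et in s_j e2 *.
  move: s_i s_j; rewrite !mem_regular_partitions_all.
  by move=> /andP[_ /eqP <-] /andP[_ /eqP <-].
move=> [s t]; apply/allpairsPdep/idP.
  move=> [i [p [i_n /allpairsP[[s' t'] /= [ms mt ->]] [-> ->]]]].
  move: ms mt i_n; rewrite !mem_regular_partitions_all mem_iota.
  rewrite /is_regular_bipartition /=.
  move=> /andP[-> /eqP ->] /andP[-> /eqP ->] i_n /=.
  by rewrite subnKC.
case/and3P=> rs rt /eqP e; rewrite /= in rs rt e; exists (sumn s), (s, t); split=> //.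
  by rewrite mem_iota /=; lia.
apply/allpairsP; exists (s, t); rewrite /= !mem_regular_partitions_all rs rt eqxx -e.
by rewrite addKn eqxx.
Qed.

(** * The generating function of regular bipartitions *)

Section BipartitionSeries.

Local Open Scope ring_scope.

Lemma regular_bipartition_series (R : comNzRingType) (l m : nat) :
  (0 < l)%N -> (0 < m)%N ->
  ((fun n => (num_regular_bipartitions l m n)%:R) : fps R) * euler R ^+ 2
  = fps_dil l (euler R) * fps_dil m (euler R) :> fps R.
Proof.
move=> l_gt0 m_gt0.
rewrite -!regular_partition_series_euler // mulrACA -expr2; congr (_ * _).
apply: fpsP => n; rewrite coef_fpsM num_regular_bipartitions_conv natr_sum.
by apply: eq_bigr => i _; rewrite natrM.
Qed.

End BipartitionSeries.

(** * Congruences modulo 13, read in a finite field of characteristic 13 *)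

Section BipartitionCongruences.

Local Open Scope ring_scope.

(** The order of 13 modulo 5 is 4, so 5 divides [13 ^ 4 - 1] and Cauchy's theorem gives a unit of
    order 5 in the field with [13 ^ 4] elements. *)
Lemma fifth_root_mod13 : exists (K : finFieldType) (w : K),
  13 \in [pchar K] /\ 1 + w + w ^+ 2 + w ^+ 3 + w ^+ 4 = 0.
Proof.
have [K pchar13 cardK] := @pPrimePowerField 13 4 isT isT.
have [x _ ox] : {x : {unit K} | x \in [set: {unit K}] & #[x]%g = 5}.
  by apply: Cauchy => //; rewrite card_finField_unit cardK.
exists K, (val x); split=> //.
have x5 : val x ^+ 5 = 1 :> K.
  by have := expg_order x; rewrite ox -FinRing.val_unitX => ->.
have x1 : val x - 1 != 0.
  rewrite subr_eq0; apply/eqP => e.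
  have : x = 1%g by apply: val_inj.
  by move/eqP; rewrite -order_eq1 ox.
apply: (mulfI x1); rewrite mulr0.
transitivity (val x ^+ 5 - 1); first by ring.
by rewrite x5 subrr.
Qed.

Notation B := (num_regular_bipartitions 5 13).

Section Field.

Variables (K : finFieldType) (w : K).
Hypothesis pchar13 : 13 \in [pchar K].
Hypothesis w_cyclotomic : 1 + w + w ^+ 2 + w ^+ 3 + w ^+ 4 = 0.

Let char13 : 13%:R = 0 :> K.
Proof. exact: pcharf0 pchar13. Qed.

Lemma bipartition_series_mod13 n :
  (B n)%:R = (euler K ^+ 11 * fps_dil 5 (euler K)) n.
Proof.
have [f phi_f] := euler_unit K.
have phi_f2 : euler K ^+ 2 * f ^+ 2 = 1 by rewrite -exprMn phi_f expr1n.
pose s : fps K := fun n => (B n)%:R.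
rewrite -[LHS]/(s n); congr (_ n); apply: (mulr_cancel phi_f2).
rewrite mulrC regular_bipartition_series // -euler_exp13 //.
by ring.
Qed.

Lemma natr_mod13 x y : x%:R = y%:R :> K -> (x = y %[mod 13])%N.
Proof.
wlog le_yx : x y / (y <= x)%N => [th|] e.
  by case: (leqP y x) => [|/ltnW] le; [|symmetry]; apply: th.
apply/eqP; rewrite eqn_mod_dvd // (dvdn_pcharf pchar13) natrB //.
by rewrite e subrr.
Qed.

(** The section applied first is the outermost affine map of the index, so the residues 1, 3, 1, 3,
    1, 3 are read from outside inwards. *)
Lemma bipartition_section6 n :
  B (5 * (5 * (5 * (5 * (5 * (5 * n + 3) + 1) + 3) + 1) + 3) + 1)%N
  = (8 * B n)%N %[mod 13].
Proof.
have [f phi_f] := euler_unit K.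
apply: natr_mod13; rewrite natrM !bipartition_series_mod13 -coef_fps_natM.
by rewrite -(alternate_sections6 w_cyclotomic char13 phi_f).
Qed.

Lemma bipartition_section5 n r : (r < 2)%N ->
  B (5 * (5 * (5 * (5 * (5 * (5 * n + r) + 1) + 3) + 1) + 3) + 1)%N
  = 0%N %[mod 13].
Proof.
move=> lt_r2; have [f phi_f] := euler_unit K.
apply: natr_mod13; rewrite bipartition_series_mod13.
exact: (congr1 (fun h : fps K => h n)
          (alternate_sections5_vanish w_cyclotomic char13 phi_f lt_r2)).
Qed.

End Field.

End BipartitionCongruences.

Theorem theorem1p4 :
  forall n m : nat,
    num_regular_bipartitions 5 13
        (5 ^ (6 * m) * n + (2 * 5 ^ (6 * m) - 2) %/ 3)
      = 8 ^ m * num_regular_bipartitions 5 13 n %[mod 13]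
    /\ (forall k : nat, k = 1 \/ k = 5 ->
        num_regular_bipartitions 5 13
            (5 ^ (6 * m + 6) * n + ((3 * k + 1) * 5 ^ (6 * m + 5) - 2) %/ 3)
          = 0 %[mod 13]).
Proof.
move=> n m.
have [K [w [pchar13 w_cyclotomic]]] := fifth_root_mod13.
have step6 := bipartition_section6 pchar13 w_cyclotomic.
have step5 := bipartition_section5 pchar13 w_cyclotomic.
have exp56 : 5 ^ 6 = 5 * (5 * (5 * (5 * (5 * 5)))) by [].
have exp55 : 5 ^ 5 = 5 * (5 * (5 * (5 * 5))) by [].
(* This makes the divisions by 3 in the statement exact. The witness uses
   [5 ^ 6 - 1 = 3 * (24 * 217)]. *)
have exp_mod3 k : exists t, 5 ^ (6 * k) = 3 * t + 1.
  elim: k => [|k [t IHk]]; first by exists 0.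
  by exists (24 * 217 * (3 * t + 1) + t); rewrite mulnS expnD IHk exp56; lia.
have iterate k j : num_regular_bipartitions 5 13
      (5 ^ (6 * k) * j + (2 * 5 ^ (6 * k) - 2) %/ 3)
    = 8 ^ k * num_regular_bipartitions 5 13 j %[mod 13].
  elim: k j => [|k IHk] j; first by rewrite !mul1n addn0.
  have [t et] := exp_mod3 k.
  (* Six nested maps send [j] to [5 ^ 6 * j + 10416], and 10416 is [(2 * 5 ^ 6 - 2) %/ 3], so the
     index shifts compose. *)
  have -> : 5 ^ (6 * k.+1) * j + (2 * 5 ^ (6 * k.+1) - 2) %/ 3
      = 5 ^ (6 * k) * (5 * (5 * (5 * (5 * (5 * (5 * j + 3) + 1) + 3) + 1) + 3) + 1)
        + (2 * 5 ^ (6 * k) - 2) %/ 3.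
    by rewrite mulnS expnD et exp56; lia.
  by rewrite IHk -modnMmr step6 modnMmr mulnA -expnSr.
split=> [|k k15]; first exact: iterate.
have [t et] := exp_mod3 m.
have vanish j : num_regular_bipartitions 5 13 j = 0 %[mod 13] ->
    num_regular_bipartitions 5 13 (5 ^ (6 * m) * j + (2 * 5 ^ (6 * m) - 2) %/ 3)
    = 0 %[mod 13].
  by move=> j0; rewrite iterate -modnMmr j0 mod0n muln0.
case: k15 => ->.
  (* For [k = 1] the innermost residue is 1: at [m = 0] the constant is 4166, the image of 1 under
     the five outer maps. *)
  rewrite (_ : _ + _ = 5 ^ (6 * m)
    * (5 * (5 * (5 * (5 * (5 * (5 * n + 1) + 1) + 3) + 1) + 3) + 1)
    + (2 * 5 ^ (6 * m) - 2) %/ 3); last first.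
    by rewrite !(expnD 5 (6 * m)) et exp55 exp56; lia.
  by apply: vanish; apply: step5.
(* For [k = 5] the constant at [m = 0] is 16666, which exceeds the modulus [5 ^ 6]; hence [n.+1]
   with innermost residue 0. *)
rewrite (_ : _ + _ = 5 ^ (6 * m)
  * (5 * (5 * (5 * (5 * (5 * (5 * n.+1 + 0) + 1) + 3) + 1) + 3) + 1)
  + (2 * 5 ^ (6 * m) - 2) %/ 3); last first.
  by rewrite !(expnD 5 (6 * m)) et exp55 exp56; lia.
by apply: vanish; apply: step5.
Qed.
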